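(* Let $s_1,\ldots,s_k$ be arbitrary integers and let $f(x),g(x)\in\mathbb{Z}[x]$ have positive leading coefficients. Then \[ S_{f(p),g(p)}(s_1,\ldots,s_k)\in\mathrm{Fil}^{-\deg(f)\left([s_1]^++\cdots+[s_k]^+\right)}\mathcal{M},\qquad S^{(p)}_{f(p),g(p)}(s_1,\ldots,s_k)\in\mathrm{Fil}^0\mathcal{M}. \]
   Context: For non-negative integers $N,M$ and arbitrary integers $s_1,\ldots,s_k$: $S_{N,M}(s_1,\ldots,s_k):=\sum_{N\geq n_1>\cdots>n_k\geq M+1}\frac{1}{n_1^{s_1}\cdots n_k^{s_k}}$ and $S^{(p)}_{N,M}(s_1,\ldots,s_k)$ is the same sum restricted to $p\nmid n_1\cdots n_k$. $[n]^+$ is $n$ if $n>0$ and $0$ otherwise. A composition is a finite list $\mathbf{s}=(s_1,\ldots,s_j)$ of positive integers, $|\mathbf{s}|=s_1+\cdots+s_j$, and $H_N(\mathbf{s})=\sum_{N\ge n_1>\cdots>n_j\ge1}\prod n_i^{-s_i}$. Let $\mathbb{Q}_{p\to\infty}$ be the quotient of the ring of sequences $(a_p)_p\in\prod_p\mathbb{Q}_p$ (indexed by primes) with $v_p(a_p)$ bounded below, by the ideal of sequences with $v_p(a_p)\to\infty$; a quantity defined for all but finitely many $p$ gives an element of it. It is a complete topological ring with filtration $\mathrm{Fil}^n\mathbb{Q}_{p\to\infty}=\{(a_p): a_p\in p^n\mathbb{Z}_p$ for all but finitely many $p\}$. The MHS algebra $\mathcal{M}\subset\mathbb{Q}_{p\to\infty}$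 consists of those $(a_p)$ for which there are rationals $c_i$, integers $b_i\to\infty$ and compositions $\mathbf{s}_i$, independent of $p$, with $(a_p)=\sum_{i\ge1}c_ip^{b_i}H_{p-1}(\mathbf{s}_i)$ in $\mathbb{Q}_{p\to\infty}$ (equivalently, for every integer $n$, $a_p\equiv\sum_{b_i<n}c_ip^{b_i}H_{p-1}(\mathbf{s}_i)\pmod{p^n}$ for all sufficiently large $p$). $\mathrm{Fil}^n\mathcal{M}$ is the set of $(a_p)\in\mathcal{M}$ admitting such an expansion with $b_i\geq n$ for all $i$. *)

(* Defs.v *)
From HB Require Import structures.
From mathcomp Require Import all_boot all_order all_algebra.
From mathcomp Require Import boolp classical_sets functions.

Set Implicit Arguments.
Unset Strict Implicit.
Unset Printing Implicit Defensive.

Import Order.TTheory GRing.Theory Num.Theory.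
Local Open Scope ring_scope.
Local Open Scope quotient_scope.

Definition primeT := {p : nat | prime p}.
Definition nat_of_primeT (p : primeT) : nat := val p.
Coercion nat_of_primeT : primeT >-> nat.

Lemma primeTP (p : primeT) : prime p.
Proof. exact: valP p. Qed.

Definition eventually_nat (P : nat -> Prop) : Prop :=
  exists N : nat, forall i, (N <= i)%N -> P i.

Lemma eventually_natI (P Q : nat -> Prop) :
  eventually_nat P -> eventually_nat Q -> eventually_nat (fun i => P i /\ Q i).
Proof.
move=> [N HN] [M HM]; exists (maxn N M) => i; rewrite geq_max => /andP[h1 h2].
by split; [exact: HN|exact: HM].
Qed.

Definition almost_all_primes (P : primeT -> Prop) : Prop :=
  exists N : nat, forall p : primeT, (N <= p)%N -> P p.

Lemma almost_all_primesI (P Q : primeT -> Prop) :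
  almost_all_primes P -> almost_all_primes Q ->
  almost_all_primes (fun p => P p /\ Q p).
Proof.
move=> [N HN] [M HM]; exists (maxn N M) => i; rewrite geq_max => /andP[h1 h2].
by split; [exact: HN|exact: HM].
Qed.

(* Junk value [vp p 0 = 0]; [vp_ge] treats [0] as having infinite valuation. *)
Definition vp (p : nat) (x : rat) : int :=
  (logn p `|numq x|)%:Z - (logn p `|denq x|)%:Z.

Definition vp_ge (p : nat) (n : int) (x : rat) : Prop :=
  x = 0 \/ n <= vp p x.

Section RatValuation.
Variable p : primeT.
Implicit Types (m n : int) (x y : rat).

Lemma vp_frac (a d : int) : a != 0 -> d != 0 ->
  vp p (a%:~R / d%:~R) = (logn p `|a|)%:Z - (logn p `|d|)%:Z.
Proof.
move=> a0 d0; set x := a%:~R / d%:~R.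
have d0' : d%:~R != 0 :> rat by rewrite intr_eq0.
have x0 : x != 0 by rewrite mulf_neq0 ?invr_eq0 ?intr_eq0.
have E : a * denq x = d * numq x.
  apply/eqP; rewrite -(eqr_int rat) !intrM numqE mulrA; apply/eqP.
  by congr (_ * _); rewrite /x mulrC divfK.
have /(congr1 (fun z => logn p `|z|%N)) := E.
rewrite !abszM !lognM ?absz_gt0 ?denq_neq0 ?numq_eq0 // => H.
rewrite /vp; apply/eqP; rewrite subr_eq addrAC eq_sym subr_eq -!PoszD.
by rewrite H addnC.
Qed.

Lemma vp_ge_frac n (a d : int) : d != 0 ->
  vp_ge p n (a%:~R / d%:~R) <->
  (if (n + (logn p `|d|)%:Z)%R is Posz k then (p ^ k %| `|a|)%N else true).
Proof.
move=> d0; have d0' : d%:~R != 0 :> rat by rewrite intr_eq0.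
have [->|a0] := eqVneq a 0.
  rewrite mul0r; split=> [_|_]; last by left.
  by case: (n + _) => // k; rewrite absz0 dvdn0.
have x0 : a%:~R / d%:~R != 0 :> rat by rewrite mulf_neq0 ?invr_eq0 ?intr_eq0.
have -> : vp_ge p n (a%:~R / d%:~R) <->
          n + (logn p `|d|)%:Z <= (logn p `|a|)%:Z.
  rewrite /vp_ge vp_frac // lerBrDr; split=> [[/eqP|//]|]; last by right.
  by rewrite (negPf x0).
case: (n + _) => [k|k]; last by split.
by rewrite lez_nat pfactor_dvdn ?primeTP // absz_gt0.
Qed.

Lemma rat_frac2 x y : exists a b d : int,
  [/\ d != 0, x = a%:~R / d%:~R & y = b%:~R / d%:~R].
Proof.
exists (numq x * denq y), (numq y * denq x), (denq x * denq y).
have dx : (denq x)%:~R != 0 :> rat by rewrite intr_eq0 denq_neq0.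
have dy : (denq y)%:~R != 0 :> rat by rewrite intr_eq0 denq_neq0.
split; first by rewrite mulf_neq0 ?denq_neq0.
  by rewrite !intrM -mulf_div divff // mulr1 divq_num_den.
by rewrite !intrM [(denq x)%:~R * _]mulrC -mulf_div divff // mulr1 divq_num_den.
Qed.

Lemma vp_ge0 n : vp_ge p n 0. Proof. by left. Qed.

Lemma vp_geN n x : vp_ge p n x -> vp_ge p n (- x).
Proof.
rewrite /vp_ge /vp numqN denqN abszN => -[->|]; last by right.
by left; rewrite oppr0.
Qed.

Lemma vp_geD n x y : vp_ge p n x -> vp_ge p n y -> vp_ge p n (x + y).
Proof.
have [a [b [d [d0 -> ->]]]] := rat_frac2 x y.
rewrite -mulrDl -intrD !vp_ge_frac //; case: (n + _) => // k.
have E c : (p ^ k %| `|c|)%N = (((p ^ k)%N)%:Z %| c)%Z by rewrite dvdzE.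
by rewrite !E => pa pb; exact: rpredD.
Qed.

Lemma vp_geB n x y : vp_ge p n x -> vp_ge p n y -> vp_ge p n (x - y).
Proof. by move=> hx hy; apply: vp_geD => //; apply: vp_geN. Qed.

Lemma vp_geM m n x y : vp_ge p m x -> vp_ge p n y -> vp_ge p (m + n) (x * y).
Proof.
have [->|x0] := eqVneq x 0; first by rewrite mul0r; left.
have [->|y0] := eqVneq y 0; first by rewrite mulr0; left.
move=> [/eqP|mx]; first by rewrite (negPf x0).
move=> [/eqP|ny]; first by rewrite (negPf y0).
right; rewrite -[x]divq_num_den -[y]divq_num_den mulf_div -!intrM.
rewrite vp_frac ?mulf_neq0 ?denq_neq0 ?numq_eq0 //.
rewrite !abszM !lognM ?absz_gt0 ?denq_neq0 ?numq_eq0 // !PoszD opprD.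
by rewrite addrACA lerD.
Qed.

Lemma vp_ge_le m n x : m <= n -> vp_ge p n x -> vp_ge p m x.
Proof. by move=> mn [->|nx]; [left|right; apply: le_trans nx]. Qed.

Lemma vp_ge_int (a : int) : vp_ge p 0 a%:~R.
Proof.
by right; rewrite /vp numq_int denq_int logn1 subr0.
Qed.

Lemma vp_ge_low x : exists n, vp_ge p n x.
Proof. by exists (vp p x); right. Qed.

Lemma vp_ge1F : ~ vp_ge p 1 1.
Proof.
by rewrite /vp_ge /vp (numq_int 1) (denq_int 1) logn1 subr0 => -[].
Qed.

End RatValuation.

Section Padic.
Variable p : primeT.

Definition cauchy_seq (u : nat -> rat) : Prop :=
  forall n : int, exists N : nat, forall i j : nat,
    (N <= i)%N -> (N <= j)%N -> vp_ge p n (u i - u j).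

Definition cauchy_pred : {pred nat -> rat} := [pred u | `[< cauchy_seq u >]].

Lemma cauchy_low u : cauchy_seq u ->
  exists m : int, eventually_nat (fun i => vp_ge p m (u i)).
Proof.
move=> /(_ 0)[N HN]; have [m Hm] := vp_ge_low p (u N).
exists (Num.min 0 m); exists N => i Ni; rewrite -(subrK (u N) (u i)).
apply: vp_geD; [apply: vp_ge_le (HN _ _ Ni (leqnn N))|apply: vp_ge_le Hm].
  by rewrite ge_min lexx.
by rewrite ge_min lexx orbT.
Qed.

Lemma cauchy_subring : subring_closed cauchy_pred.
Proof.
split.
- by apply/asboolP => n; exists 0%N => i j _ _; rewrite subrr; left.
- move=> u v /asboolP cu /asboolP cv; apply/asboolP => n.
  have [N HN] := cu n; have [M HM] := cv n.
  exists (maxn N M) => i j; rewrite !geq_max => /andP[Ni Mi] /andP[Nj Mj].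
  have -> : (u - v) i - (u - v) j = (u i - u j) - (v i - v j).
    by rewrite /= !opprD !opprK addrACA.
  by apply: vp_geB; [apply: HN|apply: HM].
move=> u v /asboolP cu /asboolP cv; apply/asboolP => n.
have [a [A HA]] := cauchy_low cu; have [b [B HB]] := cauchy_low cv.
have [N HN] := cu (n - b); have [M HM] := cv (n - a).
exists (maxn (maxn A B) (maxn N M)) => i j; rewrite !geq_max.
move=> /andP[/andP[Ai Bi] /andP[Ni Mi]] /andP[/andP[Aj Bj] /andP[Nj Mj]].
have -> : (u * v) i - (u * v) j = u i * (v i - v j) + (u i - u j) * v j.
  by rewrite mulrBr mulrBl addrA subrK.
apply: vp_geD.
  by rewrite -(subrKC a n); apply: vp_geM; [apply: HA|apply: HM].
by rewrite -(subrK b n); apply: vp_geM; [apply: HN|apply: HB].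
Qed.

HB.instance Definition _ :=
  GRing.isSubringClosed.Build (nat -> rat) cauchy_pred cauchy_subring.

Definition cauchyQ := {u : nat -> rat | u \in cauchy_pred}.
HB.instance Definition _ := SubChoice.on cauchyQ.
HB.instance Definition _ := [SubChoice_isSubComNzRing of cauchyQ by <:].

Lemma cauchyQP (u : cauchyQ) : cauchy_seq (val u).
Proof. exact/asboolP/(valP u). Qed.

Definition null_seq : {pred cauchyQ} :=
  [pred u | `[< forall n : int,
                eventually_nat (fun i => vp_ge p n (val u i)) >]].

Lemma null_seq_ideal : idealr_closed null_seq.
Proof.
split.
- by apply/asboolP => n; exists 0%N => i _; left.
- by apply/asboolP => /(_ 1)[N /(_ N (leqnn N)) /vp_ge1F].
move=> a u v /asboolP nu /asboolP nv; apply/asboolP => n.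
have [m am] := cauchy_low (cauchyQP a).
have [N HN] := eventually_natI am (eventually_natI (nu (n - m)) (nv n)).
exists N => i /HN[h1 [h2 h3]].
apply: (@vp_geD p n (val a i * val u i) (val v i)) => //.
by rewrite -(subrKC m n); apply: vp_geM.
Qed.

HB.instance Definition _ := isIdealr.Build cauchyQ null_seq null_seq_ideal.

Definition Qp := {ideal_quot null_seq}.
HB.instance Definition _ := GRing.ComNzRing.on Qp.

Lemma cst_cauchy (x : rat) : (fun _ : nat => x) \in cauchy_pred.
Proof. by apply/asboolP => n; exists 0%N => i j _ _; rewrite subrr; left. Qed.

Definition cst_seq (x : rat) : cauchyQ :=
  exist (fun u => u \in cauchy_pred) (fun _ => x) (cst_cauchy x).

Definition Qp_of_rat (x : rat) : Qp := \pi_Qp (cst_seq x).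

(* [Qp_vge n x] is [v_p(x) >= n], i.e. [x] lies in [p^n Z_p]. *)
Definition Qp_vge (n : int) (x : Qp) : Prop :=
  exists u : cauchyQ,
    \pi_Qp u = x /\ eventually_nat (fun i => vp_ge p n (val u i)).

Lemma Qp_vgeP n (u : cauchyQ) :
  Qp_vge n (\pi_Qp u) <-> eventually_nat (fun i => vp_ge p n (val u i)).
Proof.
split=> [[v [/eqP]]|]; last by exists u.
rewrite -Quotient.idealrBE => /asboolP/(_ n) vu vn.
have [N HN] := eventually_natI vu vn; exists N => i /HN[h1 h2].
by rewrite -[val u i](subKr (val v i)); apply: vp_geB.
Qed.

Lemma Qp_vge0 n : Qp_vge n 0.
Proof.
have -> : 0 = \pi_Qp (0 : cauchyQ) by rewrite rmorph0.
by apply/Qp_vgeP; exists 0%N => i _; left.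
Qed.

Lemma Qp_vgeB n (x y : Qp) : Qp_vge n x -> Qp_vge n y -> Qp_vge n (x - y).
Proof.
rewrite -[x]reprK -[y]reprK -rmorphB => /Qp_vgeP hx /Qp_vgeP hy.
apply/Qp_vgeP; have [N HN] := eventually_natI hx hy.
by exists N => i /HN[h1 h2]; apply: vp_geB.
Qed.

Lemma Qp_vgeD n (x y : Qp) : Qp_vge n x -> Qp_vge n y -> Qp_vge n (x + y).
Proof.
move=> hx hy; rewrite -[y]opprK -[- y]add0r; apply: Qp_vgeB => //.
by apply: Qp_vgeB => //; apply: Qp_vge0.
Qed.

Lemma Qp_vgeM m n (x y : Qp) :
  Qp_vge m x -> Qp_vge n y -> Qp_vge (m + n) (x * y).
Proof.
rewrite -[x]reprK -[y]reprK -rmorphM => /Qp_vgeP hx /Qp_vgeP hy.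
apply/Qp_vgeP; have [N HN] := eventually_natI hx hy.
by exists N => i /HN[h1 h2]; apply: vp_geM.
Qed.

Lemma Qp_vge_le m n (x : Qp) : m <= n -> Qp_vge n x -> Qp_vge m x.
Proof.
rewrite -[x]reprK => mn /Qp_vgeP[N HN]; apply/Qp_vgeP.
by exists N => i /HN; apply: vp_ge_le.
Qed.

Lemma Qp_vge_rat n (x : rat) : Qp_vge n (Qp_of_rat x) <-> vp_ge p n x.
Proof.
split=> [/Qp_vgeP[N /(_ N (leqnn N))] //|hx].
by apply/Qp_vgeP; exists 0%N.
Qed.

Lemma Qp_of_rat_is_zmod_morphism : zmod_morphism Qp_of_rat.
Proof.
by move=> x y; rewrite /Qp_of_rat -rmorphB; congr (\pi_Qp _); apply: val_inj.
Qed.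

Lemma Qp_of_rat_is_monoid_morphism : monoid_morphism Qp_of_rat.
Proof.
split=> [|x y].
  rewrite -[RHS](rmorph1 (\pi_Qp : cauchyQ -> Qp)).
  by congr (\pi_Qp _); apply: val_inj.
by rewrite /Qp_of_rat -rmorphM; congr (\pi_Qp _); apply: val_inj.
Qed.

HB.instance Definition _ :=
  GRing.isZmodMorphism.Build rat Qp Qp_of_rat Qp_of_rat_is_zmod_morphism.
HB.instance Definition _ :=
  GRing.isMonoidMorphism.Build rat Qp Qp_of_rat Qp_of_rat_is_monoid_morphism.

Lemma Qp_vge1 : Qp_vge 0 1.
Proof. by rewrite -(rmorph1 Qp_of_rat); apply/Qp_vge_rat/(vp_ge_int p 1). Qed.

Lemma Qp_vge1F : ~ Qp_vge 1 1.
Proof. by rewrite -(rmorph1 Qp_of_rat) => /Qp_vge_rat/vp_ge1F. Qed.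

Lemma vp_geV n x : ~ vp_ge p n x -> x != 0 /\ vp_ge p (- n) x^-1.
Proof.
move=> hn; have x0 : x != 0 by apply/eqP => x0; apply: hn; left.
split=> //; right; rewrite -[x]divq_num_den invf_div.
rewrite vp_frac ?denq_neq0 ?numq_eq0 // -opprB lerN2.
by apply/ltW; rewrite ltNge; apply/negP => h; apply: hn; right.
Qed.

Lemma cauchy_away0 (u : cauchyQ) : u \notin null_seq ->
  exists n : int, eventually_nat (fun i => ~ vp_ge p n (val u i)).
Proof.
move=> /asboolP/existsNP[n hn]; have [N HN] := cauchyQP u n.
exists n, N => i Ni ui; apply: hn; exists N => j Nj.
by rewrite -(subrK (val u i) (val u j)); apply: vp_geD => //; apply: HN.
Qed.

Lemma cauchy_inv (u : cauchyQ) : u \notin null_seq ->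
  (fun i => (val u i)^-1) \in cauchy_pred.
Proof.
move=> /cauchy_away0[n hn]; apply/asboolP => m.
have [N HN] := hn; have [M HM] := cauchyQP u (m + n + n).
exists (maxn N M) => i j; rewrite !geq_max => /andP[Ni Mi] /andP[Nj Mj].
have [ui0 ui] := vp_geV (HN _ Ni); have [uj0 uj] := vp_geV (HN _ Nj).
have -> : (val u i)^-1 - (val u j)^-1 =
          (val u j - val u i) * (val u i)^-1 * (val u j)^-1.
  by rewrite mulrBl divff // mulrBl mul1r mulrAC divff // mul1r.
have -> : m = (m + n + n) - n - n by rewrite !addrK.
by apply: vp_geM => //; apply: vp_geM => //; apply: HM.
Qed.

Lemma Qp_inv_ex (x : Qp) : exists y : Qp, if x != 0 then y * x = 1 else y = 0.
Proof.
have [_|x0] := eqVneq x 0; first by exists 0.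
have nx : repr x \notin null_seq.
  by rewrite -[repr x]subr0 Quotient.idealrBE reprK rmorph0.
exists (\pi_Qp (exist (fun u => u \in cauchy_pred) _ (cauchy_inv nx) : cauchyQ)).
rewrite -[x in _ * x]reprK -rmorphM /= -[RHS](rmorph1 (\pi_Qp : cauchyQ -> Qp)).
apply/eqP; rewrite -Quotient.idealrBE; apply/asboolP => n.
have [m [N HN]] := cauchy_away0 nx; exists N => i /HN/vp_geV[ui _]; left.
by apply/eqP; rewrite subr_eq0; apply/eqP; exact: mulVf.
Qed.

Definition Qp_inv (x : Qp) : Qp := sval (cid (Qp_inv_ex x)).

Lemma Qp_mulVf (x : Qp) : x != 0 -> Qp_inv x * x = 1.
Proof. by rewrite /Qp_inv; case: cid => y /=; case: eqVneq. Qed.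

Lemma Qp_inv0 : Qp_inv 0 = 0.
Proof. by rewrite /Qp_inv; case: cid => y /=; rewrite eqxx. Qed.

HB.instance Definition _ := GRing.ComNzRing_isField.Build Qp Qp_mulVf Qp_inv0.

End Padic.

Definition prodQp := forall p : primeT, Qp p.
HB.instance Definition _ := gen_eqMixin prodQp.
HB.instance Definition _ := gen_choiceMixin prodQp.

Section ProdQp.
Let zero : prodQp := fun p => 0.
Let one : prodQp := fun p => 1.
Let opp (a : prodQp) : prodQp := fun p => - a p.
Let add (a b : prodQp) : prodQp := fun p => a p + b p.
Let mul (a b : prodQp) : prodQp := fun p => a p * b p.

Let addA : associative add.
Proof. by move=> a b c; apply: functional_extensionality_dep => p; apply: addrA. Qed.
Let addC : commutative add.
Proof. by move=> a b; apply: functional_extensionality_dep => p; apply: addrC. Qed.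
Let add0 : left_id zero add.
Proof. by move=> a; apply: functional_extensionality_dep => p; apply: add0r. Qed.
Let addN : left_inverse zero opp add.
Proof. by move=> a; apply: functional_extensionality_dep => p; apply: addNr. Qed.

HB.instance Definition _ := GRing.isZmodule.Build prodQp addA addC add0 addN.

Let mulA : associative mul.
Proof. by move=> a b c; apply: functional_extensionality_dep => p; apply: mulrA. Qed.
Let mulC : commutative mul.
Proof. by move=> a b; apply: functional_extensionality_dep => p; apply: mulrC. Qed.
Let mul1 : left_id one mul.
Proof. by move=> a; apply: functional_extensionality_dep => p; apply: mul1r. Qed.
Let mulD : left_distributive mul add.
Proof. by move=> a b c; apply: functional_extensionality_dep => p; apply: mulrDl. Qed.
Let one_neq0 : one != 0 :> prodQp.
Proof.
apply/eqP => /(congr1 (fun a : prodQp => a (exist _ 2%N isT : primeT))) /eqP.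
by rewrite (negPf (oner_neq0 _)).
Qed.

HB.instance Definition _ :=
  GRing.Zmodule_isComNzRing.Build prodQp mulA mulC mul1 mulD one_neq0.
End ProdQp.

Definition bounded_pred : {pred prodQp} :=
  [pred a : prodQp | `[< exists m : int, forall p, Qp_vge m (a p) >]].

Lemma bounded_subring : subring_closed bounded_pred.
Proof.
split.
- apply/asboolP; exists 0 => p.
  exact: Qp_vge1.
- move=> a b /asboolP[m Hm] /asboolP[n Hn]; apply/asboolP.
  exists (Num.min m n) => p; apply: Qp_vgeB.
    by apply: Qp_vge_le (Hm p); rewrite ge_min lexx.
  by apply: Qp_vge_le (Hn p); rewrite ge_min lexx orbT.
move=> a b /asboolP[m Hm] /asboolP[n Hn]; apply/asboolP.
by exists (m + n) => p; apply: Qp_vgeM.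
Qed.

HB.instance Definition _ :=
  GRing.isSubringClosed.Build prodQp bounded_pred bounded_subring.

Definition boundedQp := {a : prodQp | a \in bounded_pred}.
HB.instance Definition _ := SubChoice.on boundedQp.
HB.instance Definition _ := [SubChoice_isSubComNzRing of boundedQp by <:].

Definition null_family : {pred boundedQp} :=
  [pred a | `[< forall n : int,
                almost_all_primes (fun p => Qp_vge n (val a p)) >]].

Lemma null_family_ideal : idealr_closed null_family.
Proof.
split.
- by apply/asboolP => n; exists 0%N => p _; apply: Qp_vge0.
- apply/asboolP => /(_ 1)[N]; have [q Nq pq] := prime_above N.
  by move=> /(_ (exist _ q pq : primeT) (ltnW Nq)) /Qp_vge1F.
move=> a u v /asboolP nu /asboolP nv; apply/asboolP => n.
have /asboolP[m Hm] := valP a.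
have [N HN] := almost_all_primesI (nu (n - m)) (nv n).
exists N => p /HN[h1 h2].
apply: (@Qp_vgeD p n (val a p * val u p) (val v p)) => //.
by rewrite -(subrKC m n); apply: Qp_vgeM.
Qed.

HB.instance Definition _ :=
  isIdealr.Build boundedQp null_family null_family_ideal.

Definition Qpinf := {ideal_quot null_family}.
HB.instance Definition _ := GRing.ComNzRing.on Qpinf.

(* A quantity defined for almost all [p], here rational-valued, determines an
   element of [Qpinf]: the class of any bounded family which agrees with it at
   almost all [p].  The class exists only if the quantity has valuations bounded
   below at almost all [p], so it is given as a relation. *)
Definition is_class_of (a : primeT -> rat) (x : Qpinf) : Prop :=
  exists u : boundedQp,
    \pi_Qpinf u = x /\
    almost_all_primes (fun p => val u p = Qp_of_rat p (a p)).

Definition Fil (n : int) : set Qpinf :=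
  fun x => exists u : boundedQp,
    \pi_Qpinf u = x /\ almost_all_primes (fun p => Qp_vge n (val u p)).

(* Convergence for the topology defined by the filtration [Fil]. *)
Definition is_series_sum (t : nat -> Qpinf) (x : Qpinf) : Prop :=
  forall n : int, eventually_nat (fun m => Fil n (x - \sum_(i < m) t i)).

(* The sum runs over [N >= n_1 > ... > n_k >= M+1], with [k = size s],
   subject to the further condition [P] on [n_1 ... n_k]. *)
Definition mhs_restr (P : pred nat) (N M : nat) (s : seq int) : rat :=
  \sum_(n : (size s).-tuple 'I_N.+1
         | [&& sorted gtn (map val n), all (fun x : 'I_N.+1 => (M < x)%N) n
             & P (\prod_(i < size s) tnth n i)%N])
    \prod_(i < size s) ((tnth n i : nat)%:R ^ s`_i)^-1.

Definition S_sum (N M : nat) (s : seq int) : rat := mhs_restr predT N M s.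

Definition S_sum_p (p N M : nat) (s : seq int) : rat :=
  mhs_restr (fun m => ~~ (p %| m)%N) N M s.

Definition is_composition (s : seq nat) : bool := all (fun x => (0 < x)%N) s.

Definition H_sum (N : nat) (s : seq nat) : rat := S_sum N 0 (map Posz s).

Definition mhs_expansion (c : nat -> rat) (b : nat -> int)
    (s : nat -> seq nat) (x : Qpinf) : Prop :=
  [/\ forall B : int, eventually_nat (fun i => B <= b i),
      forall i, is_composition (s i)
    & exists2 t : nat -> Qpinf,
        forall i, is_class_of
          (fun p => c i * (p%:R ^ b i) * H_sum p.-1 (s i)) (t i)
        & is_series_sum t x].

Definition MHS : set Qpinf :=
  fun x => exists c b s, mhs_expansion c b s x.

Definition FilMHS (n : int) : set Qpinf :=
  fun x => exists c b s, mhs_expansion c b s x /\ forall i, n <= b i.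

Definition pos_part (n : int) : int := if 0 < n then n else 0.

(* Values of a polynomial with positive leading coefficient are natural numbers
   at almost all [p]; at the other [p] the absolute value is a junk value. *)
Definition poly_val (f : {poly int}) (p : nat) : nat := `|f.[p%:Z]|%N.

(* Main.v *)
From HB Require Import structures.
Require Import Defs.
From mathcomp Require Import all_boot all_order all_algebra.
From mathcomp Require Import boolp classical_sets functions filter.
From mathcomp Require Import ring zify.

(** Cut the range [1 .. p m] into the blocks [(p i, p (i + 1)]]. Splitting a
    nested sum at the block boundaries writes [S_{pm}(s)] as a sum over [i < m]
    of block sums times [S_{pi}(s')] with [s'] shorter than [s]. In a block, the
    geometric series of [(p i + r)^-1] expands the part prime to [p] into powers
    of [p], powers of [i] and sums [H_{p-1}(u)], while the multiple of [p]
    contributes [(p (i + 1))^-a]; hence [S_{pm}(s)] is a [p]-adically convergent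
    combination of products [p^k H_{p-1}(u) S_m(e)]. Writing [f = x q + c] and
    taking [m = q(p)], this gives an induction on [deg f]; the [|c|] remaining
    terms at the end are powers of polynomials in [p]. The lower bound [g(p)] is
    reached by splitting the range at [g(p)]. Products of the [H_{p-1}(u)] are
    linearised by the quasi-shuffle product; nonpositive exponents are removed
    by summation by parts. The restricted sums only omit the multiples of [p],
    which are the sole source of negative powers of [p]. *)

Set Implicit Arguments.
Unset Strict Implicit.
Unset Printing Implicit Defensive.

Import Order.TTheory GRing.Theory Num.Theory.
Local Open Scope ring_scope.
Local Open Scope quotient_scope.
Local Open Scope classical_set_scope.

(** * Additive subgroups spanned by a set *)

Section AdditiveSpan.
Variable V : zmodType.
Implicit Types (G : set V) (u v : V).

Inductive in_zspan G : V -> Prop :=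
| in_zspan0 : in_zspan G 0
| in_zspan_gen g of G g : in_zspan G g
| in_zspanB u v of in_zspan G u & in_zspan G v : in_zspan G (u - v).

Definition zspan G : {pred V} := [pred v | `[< in_zspan G v >]].

Lemma zspan_zmod_closed G : zmod_closed (zspan G).
Proof.
split=> [|u v /asboolP Gu /asboolP Gv]; apply/asboolP; first exact: in_zspan0.
exact: in_zspanB.
Qed.

HB.instance Definition _ G :=
  GRing.isZmodClosed.Build V (zspan G) (zspan_zmod_closed G).

Lemma mem_zspan G g : G g -> g \in zspan G.
Proof. by move=> Gg; apply/asboolP/in_zspan_gen. Qed.

End AdditiveSpan.

Lemma zspan_morph (U V : zmodType) (G : set U) (S : zmodClosed V) (f : U -> V) :
  zmod_morphism f -> (forall g, G g -> f g \in S) ->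
  forall u, u \in zspan G -> f u \in S.
Proof.
move=> fB fG u /asboolP; elim=> [|//|v w _ IHv _ IHw].
  by rewrite -[0](subrr 0) fB subrr rpred0.
by rewrite fB rpredB.
Qed.

Lemma zspanM (R : pzRingType) (G H : set R) (S : zmodClosed R) :
  (forall g h, G g -> H h -> g * h \in S) ->
  forall u v, u \in zspan G -> v \in zspan H -> u * v \in S.
Proof.
move=> GH u v Gu; apply: zspan_morph => [x y|h Hh]; first exact: mulrBr.
apply: (zspan_morph (f := fun x => x * h)) Gu => [x y|g Gg].
  exact: mulrBl.
exact: GH.
Qed.

(** * Nested sums *)

Section NestedSums.
Variables (A : Type) (R : comPzRingType).
Implicit Types (W : A -> nat -> R) (s : seq A).

Fixpoint nsum W s (n : nat) : R :=
  if s is a :: s' then \sum_(i < n) W a i * nsum W s' i else 1.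

Lemma nsum_cons W a s n :
  nsum W (a :: s) n = \sum_(i < n) W a i * nsum W s i.
Proof. by []. Qed.

Lemma nsumS W a s n :
  nsum W (a :: s) n.+1 = nsum W (a :: s) n + W a n * nsum W s n.
Proof. by rewrite /= big_ord_recr. Qed.

Lemma nsum0 W s : nsum W s 0 = (nilp s)%:R.
Proof. by case: s => //= a s; rewrite big_ord0. Qed.

Lemma eq_nsum W W' s n :
  (forall a i, (i < n)%N -> W a i = W' a i) -> nsum W s n = nsum W' s n.
Proof.
elim: s n => //= a s IH n eqW; apply: eq_bigr => i _.
rewrite eqW // (IH i) // => b j ji; apply: eqW; exact: ltn_trans (ltn_ord i).
Qed.

Lemma nsum_scale (c : A -> R) W s n :
  nsum (fun a i => c a * W a i) s n = (\prod_(a <- s) c a) * nsum W s n.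
Proof.
elim: s n => [|a s IH] n; first by rewrite big_nil mulr1.
rewrite big_cons /= mulr_sumr; apply: eq_bigr => i _; rewrite IH; ring.
Qed.

Lemma nsum_cat W s M N : nsum W s (M + N) =
  \sum_(k < (size s).+1) nsum (fun a n => W a (M + n)%N) (take k s) N *
                         nsum W (drop k s) M.
Proof.
elim: s N => [|a s IH] N; first by rewrite big_ord1 /= mulr1.
rewrite [RHS]big_ord_recl mul1r /= big_split_ord /=; congr (_ + _).
transitivity (\sum_(i < N) \sum_(k < (size s).+1) W a (M + i)%N *
   (nsum (fun a n => W a (M + n)%N) (take k s) i * nsum W (drop k s) M)).
  by apply: eq_bigr => i _; rewrite IH mulr_sumr.
rewrite exchange_big /=; apply: eq_bigr => k _; rewrite mulr_suml.
by apply: eq_bigr => i _; rewrite mulrA.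
Qed.

Lemma nsum_blocks W a s p m : nsum W (a :: s) (p * m) =
  \sum_(i < m) \sum_(k < (size s).+1)
    nsum (fun a n => W a (p * i + n)%N) (a :: take k s) p *
    nsum W (drop k s) (p * i).
Proof.
elim: m => [|m IH]; first by rewrite muln0 nsum0 big_ord0.
rewrite mulnS addnC nsum_cat [(size (a :: s)).+1]/= big_ord_recl mul1r.
by rewrite [drop 0 _]/= IH [RHS]big_ord_recr.
Qed.

Lemma nsum_shift W s M K : (forall a n, (n < M)%N -> W a n = 0) ->
  nsum W s (M + K) = nsum (fun a n => W a (M + n)%N) s K.
Proof.
move=> W0; elim: s K => //= a s IH K; rewrite big_split_ord /= big1 ?add0r.
  by apply: eq_bigr => i _; rewrite IH.
by move=> i _; rewrite W0 // mul0r.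
Qed.

End NestedSums.

(* Index [n] stands for the integer [n.+1]: [hsum s N] is [S_{N,0}(s)]. *)
Definition ipow (a : int) (n : nat) : rat := n.+1%:R ^ (- a).

Local Notation hsum := (nsum ipow).

Definition hsum_nat (u : seq nat) : nat -> rat := hsum (map Posz u).

Lemma ipowD a b n : ipow a n * ipow b n = ipow (a + b) n.
Proof. by rewrite /ipow -expfzDr ?pnatr_eq0 // opprD. Qed.

Lemma ipowN j n : ipow (- j%:Z) n = n.+1%:R ^+ j.
Proof. by rewrite /ipow opprK. Qed.

Definition ipow_sum (a : int) (h : nat -> rat) (N : nat) : rat :=
  \sum_(n < N) ipow a n * h n.

Lemma ipow_sumS a h N : ipow_sum a h N.+1 = ipow_sum a h N + ipow a N * h N.
Proof. exact: big_ord_recr. Qed.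

Lemma ipow_sum_zmod_morphism a : zmod_morphism (ipow_sum a).
Proof.
move=> g h; apply: funext => N; rewrite !fctE /ipow_sum -sumrB.
by apply: eq_bigr => n _; rewrite -mulrBr.
Qed.

HB.instance Definition _ a := GRing.isZmodMorphism.Build
  (nat -> rat) (nat -> rat) (ipow_sum a) (ipow_sum_zmod_morphism a).

Lemma hsumM a u b v : hsum (a :: u) * hsum (b :: v) =
  ipow_sum a (hsum u * hsum (b :: v)) + ipow_sum b (hsum (a :: u) * hsum v) +
  ipow_sum (a + b) (hsum u * hsum v).
Proof.
apply: funext; elim=> [|N IH]; rewrite !fctE.
  by rewrite /ipow_sum /= !big_ord0 mul0r !addr0.
move: IH; rewrite !fctE !nsumS !ipow_sumS -ipowD => IHN.
rewrite mulrDl !mulrDr IHN; ring.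
Qed.

Definition hsum_compositions : set (nat -> rat) :=
  [set phi | exists2 u, is_composition u & phi = hsum_nat u].

Lemma ipow_sum_hsum_compositions (a : nat) h : (0 < a)%N ->
  h \in zspan hsum_compositions -> ipow_sum a h \in zspan hsum_compositions.
Proof.
move=> a0; apply: zspan_morph; first exact: raddfB.
by move=> _ [u cu ->]; apply: mem_zspan; exists (a :: u); rewrite //= a0.
Qed.

Lemma quasi_shuffle u v : is_composition u -> is_composition v ->
  hsum_nat u * hsum_nat v \in zspan hsum_compositions.
Proof.
have [n] := ubnP (size u + size v).
elim: n u v => // n IH [|a u] [|b v] size_uv cu cv.
- by rewrite [_ * _]mul1r; apply: mem_zspan; exists [::].
- by rewrite [_ * _]mul1r; apply: mem_zspan; exists (b :: v).
- by rewrite [_ * _]mulr1; apply: mem_zspan; exists (a :: u).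
have /andP[a0 cu'] := cu; have /andP[b0 cv'] := cv; simpl in size_uv.
rewrite /hsum_nat [_ (a :: u)]/= [_ (b :: v)]/= hsumM -PoszD.
have ab0 : (0 < a + b)%N by lia.
apply: rpredD; first apply: rpredD; apply: ipow_sum_hsum_compositions => //.
- by apply: (IH u (b :: v)) => //=; lia.
- by apply: (IH (a :: u) v) => //=; lia.
- by apply: IH => //; lia.
Qed.

(** * Nested sums with arbitrary integer exponents *)

Definition powsum (c : rat) (k : nat) (u : seq nat) (N : nat) : rat :=
  c * N%:R ^+ k * hsum_nat u N.

Definition powsum_compositions : set (nat -> rat) :=
  [set phi | exists c k u, is_composition u /\ phi = powsum c k u].

Lemma mem_powsum c k u :
  is_composition u -> powsum c k u \in zspan powsum_compositions.
Proof. by move=> cu; apply: mem_zspan; exists c, k, u. Qed.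

Lemma powsum_compositionsZ d phi :
  phi \in zspan powsum_compositions ->
  cst d * phi \in zspan powsum_compositions.
Proof.
apply: zspan_morph => [g h|_ [c [k [u [cu ->]]]]]; first exact: mulrBr.
rewrite (_ : _ * _ = powsum (d * c) k u); first exact: mem_powsum.
by apply: funext => N; rewrite !fctE /powsum !mulrA.
Qed.

Definition pred_coef (k i : nat) : rat := (-1) ^+ (k - i) *+ 'C(k, i).

Lemma expr_pred k n :
  n%:R ^+ k = \sum_(i < k.+1) pred_coef k i * n.+1%:R ^+ i :> rat.
Proof.
have -> : n%:R = -1 + n.+1%:R :> rat by rewrite -natr1; ring.
by rewrite exprDn; apply: eq_bigr => i _; rewrite mulrnAl.
Qed.

Definition forward_diff (h : nat -> rat) (n : nat) : rat := h n.+1 - h n.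

Lemma forward_diff_hsum b s : forward_diff (hsum (b :: s)) = ipow b * hsum s.
Proof.
by apply: funext => n; rewrite /forward_diff nsumS addrAC subrr add0r.
Qed.

Lemma ipow_sum_by_parts j (h : nat -> rat) N :
  N%:R ^+ j.+1 * h N = ipow_sum (- j.+1%:Z) (forward_diff h) N -
    \sum_(i < j.+1) pred_coef j.+1 i * ipow_sum (- i%:Z) h N.
Proof.
elim: N => [|N IH].
  rewrite /ipow_sum expr0n mul0r big_ord0 sub0r big1 ?oppr0 // => i _.
  by rewrite big_ord0 mulr0.
have top_coef : pred_coef j.+1 j.+1 = 1.
  by rewrite /pred_coef subnn binn expr0 mulr1n.
have := expr_pred j.+1 N; rewrite big_ord_recr /= top_coef mul1r => NE.
rewrite ipow_sumS ipowN; under eq_bigr do rewrite ipow_sumS mulrDr mulrA ipowN.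
rewrite big_split -mulr_suml /= opprD addrACA -IH NE /forward_diff; ring.
Qed.

(* Summation by parts lowers the exponent or replaces [h] by its differences. *)
Lemma ipow_sum_le0_powsum a (h : nat -> rat) : a <= 0 ->
  (forall k, (fun N => N%:R ^+ k * h N) \in zspan powsum_compositions) ->
  (forall k,
     ipow_sum (- k%:Z) (forward_diff h) \in zspan powsum_compositions) ->
  ipow_sum a h \in zspan powsum_compositions.
Proof.
move=> a0 hX hdiff; have -> : a = - `|a|%N%:Z by lia.
elim/ltn_ind: `|a|%N => j IH.
pose rhs : nat -> rat := (ipow_sum (- j.+1%:Z) (forward_diff h) -
  (fun N => N%:R ^+ j.+1 * h N)) -
  \sum_(i < j) cst (pred_coef j.+1 i) * ipow_sum (- i%:Z) h.
have -> : ipow_sum (- j%:Z) h = cst (- j.+1%:R^-1) * rhs.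
  have j0 : j.+1%:R != 0 :> rat by rewrite pnatr_eq0.
  apply: funext => N; rewrite /rhs fct_sumE !fctE ipow_sum_by_parts.
  rewrite subKr big_ord_recr /= addrAC subrr add0r.
  by rewrite /pred_coef subSn // subnn expr1 binSn mulNrn; field; rewrite nat1r.
apply: powsum_compositionsZ; apply: rpredB; first exact: rpredB.
by apply: rpred_sum => i _; apply/powsum_compositionsZ/IH.
Qed.

Lemma ipow_sumM a b h : ipow_sum a (ipow b * h) = ipow_sum (a + b) h.
Proof.
by apply: funext => N; apply: eq_bigr => n _; rewrite !fctE -ipowD mulrA.
Qed.

Lemma ipow_sum_hsum_nat a u : is_composition u ->
  ipow_sum a (hsum_nat u) \in zspan powsum_compositions.
Proof.
have [n] := ubnP (size u); elim: n u a => // n IH u a size_u cu.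
have [a0|a0] := ltP 0 a.
  have -> : ipow_sum a (hsum_nat u) = powsum 1 0 (`|a|%N :: u).
    by apply: funext => N; rewrite /powsum !mul1r /hsum_nat /= gtz0_abs.
  by apply: mem_powsum; rewrite /= absz_gt0 gt_eqF.
apply: ipow_sum_le0_powsum => // k.
  rewrite (_ : (fun _ => _) = powsum 1 k u); first exact: mem_powsum.
  by apply: funext => N; rewrite /powsum mul1r.
case: u size_u cu => [|b u] size_u cu.
  have -> : forward_diff (hsum_nat [::]) = 0.
    by apply: funext => N; rewrite /forward_diff subrr.
  by rewrite raddf0 rpred0.
by rewrite forward_diff_hsum ipow_sumM; have /andP[_] := cu; apply: IH.
Qed.

Lemma hsum_mem_powsum s : hsum s \in zspan powsum_compositions.
Proof.
elim: s => [|a s IH].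
  rewrite (_ : hsum [::] = powsum 1 0 [::]); first exact: mem_powsum.
  by apply: funext => N; rewrite /powsum !mul1r.
rewrite -[hsum (a :: s)]/(ipow_sum a (hsum s)).
apply: zspan_morph IH; first exact: raddfB.
move=> _ [c [k [u [cu ->]]]].
have -> : ipow_sum a (powsum c k u) = \sum_(i < k.+1)
    cst (c * pred_coef k i) * ipow_sum (a - i%:Z) (hsum_nat u).
  apply: funext => N; rewrite fct_sumE /ipow_sum.
  under [RHS]eq_bigr do rewrite fctE mulr_sumr.
  rewrite exchange_big; apply: eq_bigr => n _ /=.
  rewrite /powsum expr_pred mulr_sumr mulr_suml mulr_sumr.
  apply: eq_bigr => i _; rewrite -ipowD ipowN cstE.
  by move: (ipow a n) (hsum_nat u n) => x y; ring.
by apply: rpred_sum => i _; apply/powsum_compositionsZ/ipow_sum_hsum_nat.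
Qed.

(** * Weighted harmonic sums at the primes *)

Lemma primeT_gt0 (p : primeT) : (0 < p)%N.
Proof. exact: prime_gt0 (primeTP p). Qed.

Lemma natr_primeT_neq0 (p : primeT) : p%:R != 0 :> rat.
Proof. by rewrite pnatr_eq0 -lt0n primeT_gt0. Qed.

Definition weighted_hsum (c : rat) (k : nat) (u : seq nat) (p : primeT) : rat :=
  c * p%:R ^+ k * hsum_nat u p.-1.

Definition weighted_mhs : {pred primeT -> rat} :=
  zspan [set phi | exists c k u, is_composition u /\ phi = weighted_hsum c k u].

HB.instance Definition _ := GRing.ZmodClosed.on weighted_mhs.

Lemma mem_weighted_hsum c k u :
  is_composition u -> weighted_hsum c k u \in weighted_mhs.
Proof. by move=> cu; apply: mem_zspan; exists c, k, u. Qed.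

Lemma weighted_mhs_cst c : cst c \in weighted_mhs.
Proof.
rewrite (_ : cst c = weighted_hsum c 0 [::]); first exact: mem_weighted_hsum.
by apply: funext => p; rewrite /weighted_hsum !mulr1.
Qed.

Lemma weighted_mhs_mulr_closed : mulr_closed weighted_mhs.
Proof.
split; first exact: weighted_mhs_cst.
apply: zspanM => _ _ [c [k [u [cu ->]]]] [d [l [v [cv ->]]]].
pose f (h : nat -> rat) (p : primeT) := c * d * p%:R ^+ (k + l) * h p.-1.
have -> : weighted_hsum c k u * weighted_hsum d l v =
    f (hsum_nat u * hsum_nat v).
  by apply: funext => p; rewrite !fctE /weighted_hsum /f exprD; ring.
apply: zspan_morph (quasi_shuffle cu cv) => [g h|_ [w cw ->]].
  by apply: funext => p; rewrite /f !fctE mulrBr.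
exact: mem_weighted_hsum.
Qed.

HB.instance Definition _ :=
  GRing.isMulClosed.Build (primeT -> rat) weighted_mhs weighted_mhs_mulr_closed.

Lemma weighted_mhs_prime : (fun p : primeT => p%:R) \in weighted_mhs.
Proof.
rewrite (_ : (fun _ => _) = weighted_hsum 1 1 [::]).
  exact: mem_weighted_hsum.
by apply: funext => p; rewrite /weighted_hsum mul1r mulr1.
Qed.

Lemma weighted_mhs_primeX n : (fun p : primeT => p%:R ^+ n) \in weighted_mhs.
Proof. by have := rpredX n weighted_mhs_prime; rewrite exprfctE. Qed.

Lemma weighted_mhs_hsum s : (fun p : primeT => hsum s p.-1) \in weighted_mhs.
Proof.
apply: (zspan_morph (f := fun h (p : primeT) => h p.-1)) (hsum_mem_powsum s).
  by move=> g h.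
move=> _ [c [k [u [cu ->]]]].
have -> : (fun p : primeT => powsum c k u p.-1) =
    cst c * ((fun p : primeT => p%:R) - 1) ^+ k * weighted_hsum 1 0 u.
  apply: funext => p; rewrite !fctE /powsum /weighted_hsum !mul1r.
  by rewrite -subn1 natrB // primeT_gt0.
apply: rpredM; last exact: mem_weighted_hsum.
apply: rpredM; first exact: weighted_mhs_cst.
by apply/rpredX/rpredB; [exact: weighted_mhs_prime|exact: rpred1].
Qed.

Lemma weighted_mhs_poly (f : {poly rat}) :
  (fun p : primeT => f.[p%:R]) \in weighted_mhs.
Proof.
elim/poly_ind: f => [|f c IH].
  rewrite (_ : (fun _ => _) = 0) ?rpred0 //.
  by apply: funext => p; rewrite horner0.
rewrite (_ : (fun _ => _) =
  (fun p : primeT => f.[p%:R]) * (fun p => p%:R) + cst c).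
  by rewrite rpredD ?rpredM ?weighted_mhs_prime ?weighted_mhs_cst.
by apply: funext => p; rewrite hornerD hornerMX hornerC.
Qed.

(** * Valuations of rational numbers *)

Section Valuation.
Variable p : primeT.

Lemma vp_ge_sum n (I : Type) (r : seq I) (P : pred I) (F : I -> rat) :
  (forall i, P i -> vp_ge p n (F i)) -> vp_ge p n (\sum_(i <- r | P i) F i).
Proof.
move=> F_ge; elim/big_rec: _ => [|i x Pi]; first exact: vp_ge0.
by apply: vp_geD; apply: F_ge.
Qed.

Lemma vp_ge0M x y : vp_ge p 0 x -> vp_ge p 0 y -> vp_ge p 0 (x * y).
Proof. by rewrite -[X in vp_ge p X (x * y)](addr0 0); apply: vp_geM. Qed.

Lemma vp_ge0_nat (n : nat) : vp_ge p 0 (n%:R : rat).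
Proof. exact: (vp_ge_int p n). Qed.

Lemma vp_ge0X n x : vp_ge p 0 x -> vp_ge p 0 (x ^+ n).
Proof.
move=> x_ge; elim: n => [|n IH]; first exact: (vp_ge0_nat 1).
by rewrite exprS; apply: vp_ge0M.
Qed.

Lemma vp_ge_inv (n : int) : n != 0 ->
  vp_ge p (- (logn p `|n|)%:Z) (n%:~R^-1 : rat).
Proof. by move=> n0; right; rewrite -div1r (@vp_frac p 1 n) // logn1 sub0r. Qed.

Lemma vp_ge_prime_exprz (n : int) : vp_ge p n (p%:R ^ n : rat).
Proof.
case: n => n; last first.
  rewrite NegzE -invr_expz -exprnP -natrX.
  have := @vp_ge_inv (p ^ n.+1)%N; rewrite pfactorK ?primeTP //; apply.
  by rewrite eqz_nat -lt0n expn_gt0 primeT_gt0.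
rewrite -exprnP -natrX; right.
rewrite /vp (numq_int (p ^ n)%N) (denq_int (p ^ n)%N).
by rewrite logn1 subr0 /= pfactorK // primeTP.
Qed.

Lemma vp_ge0_exprz (n z : int) :
  ~~ (p%:Z %| n)%Z -> vp_ge p 0 (n%:~R ^ z : rat).
Proof.
move=> pn; case: z => k; first exact/vp_ge0X/vp_ge_int.
rewrite NegzE -invr_expz -exprVn; apply: vp_ge0X.
have n0 : n != 0 by apply: contraNneq pn => ->; apply: dvdz0.
by have := vp_ge_inv n0; rewrite logn_coprime // prime_coprime // primeTP.
Qed.

Lemma vp_ge0_nsum (A : Type) (W : A -> nat -> rat) s n :
  (forall a i, (i < n)%N -> vp_ge p 0 (W a i)) -> vp_ge p 0 (nsum W s n).
Proof.
elim: s n => [|a s IH] n W_ge; first exact: (vp_ge0_nat 1).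
apply: vp_ge_sum => i _; apply: vp_ge0M; first exact: W_ge.
by apply: IH => b j ji; apply: W_ge; apply: ltn_trans (ltn_ord i).
Qed.

Lemma vp_ge0_hsum s n : (n < p)%N -> vp_ge p 0 (hsum s n).
Proof.
move=> np; apply: vp_ge0_nsum => a i ni; apply: (@vp_ge0_exprz i.+1).
by rewrite dvdzE gtnNdvd //; apply: leq_ltn_trans np.
Qed.

End Valuation.

(** * Families of rational numbers over the primes *)

(* Estimates are asymptotic in [prime_of x], and uniform over [dom]. *)
Record primeFamily := PrimeFamily {
  point :> Type;
  prime_of : point -> primeT;
  dom : set point }.
Arguments prime_of {p}.

Definition primes_family : primeFamily := @PrimeFamily primeT id setT.

Definition pairs_family (T : Type) (D : primeT -> set T) : primeFamily :=
  @PrimeFamily (primeT * T) fst [set x | D x.1 x.2].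

Definition large_primes (X : primeFamily) : set_system X :=
  [set P | exists M : nat, forall x, dom x -> (M <= prime_of x)%N -> P x].
Arguments large_primes : clear implicits.

#[local] Instance large_primes_filter (X : primeFamily) :
  Filter (large_primes X).
Proof.
split=> [|P Q [M PM] [N QN]|P Q PQ [M PM]]; first by exists 0%N.
  exists (maxn M N) => x dx; rewrite geq_max => /andP[Mx Nx].
  by split; [apply: PM|apply: QN].
by exists M => x dx Mx; apply/PQ/PM.
Qed.

Lemma near_dom (X : primeFamily) : \forall x \near large_primes X, dom x.
Proof. by exists 0%N. Qed.

Lemma near_eventually (X : primeFamily) (P : nat -> Prop) :
  eventually_nat P -> \forall x \near large_primes X, P (prime_of x).
Proof. by move=> [M PM]; exists M => x _; apply: PM. Qed.

#[local] Instance almost_all_primes_filter : Filter almost_all_primes.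
Proof.
split=> [|P Q|P Q PQ [M PM]]; first by exists 0%N.
  exact: almost_all_primesI.
by exists M => p Mp; apply/PQ/PM.
Qed.

Lemma near_primesP (P : primeT -> Prop) :
  (\forall p \near large_primes primes_family, P p) <-> almost_all_primes P.
Proof. by split=> -[M PM]; exists M => p *; apply: PM. Qed.

Lemma near_not_dvd (X : primeFamily) (n : nat) : (0 < n)%N ->
  \forall x \near large_primes X, ~~ (prime_of x %| n)%N.
Proof.
move=> n0; apply: (@near_eventually X (fun p => ~~ (p %| n)%N)).
by exists n.+1 => p np; rewrite gtnNdvd.
Qed.

Section UniformValuation.
Variable X : primeFamily.
Implicit Types (phi psi : X -> rat) (m n : int).

Definition vge n : {pred X -> rat} := [pred phi |
  `[< \forall x \near large_primes X, vp_ge (prime_of x) n (phi x) >]].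

Lemma vge_zmod_closed n : zmod_closed (vge n).
Proof.
split=> [|phi psi /asboolP phin /asboolP psin]; apply/asboolP.
  by apply: nearW => x; apply: vp_ge0.
by apply: filterS2 phin psin => x; apply: vp_geB.
Qed.

HB.instance Definition _ n :=
  GRing.isZmodClosed.Build (X -> rat) (vge n) (vge_zmod_closed n).

Lemma vgeM m n phi psi :
  phi \in vge m -> psi \in vge n -> phi * psi \in vge (m + n).
Proof.
move=> /asboolP phim /asboolP psin; apply/asboolP.
by apply: filterS2 phim psin => x; apply: vp_geM.
Qed.

Lemma vge_le m n phi : m <= n -> phi \in vge n -> phi \in vge m.
Proof.
move=> mn /asboolP phin; apply/asboolP.
by apply: filterS phin => x; apply: vp_ge_le.
Qed.

Lemma near_eq_vge n phi psi :
  (\forall x \near large_primes X, phi x = psi x) ->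
  psi \in vge n -> phi \in vge n.
Proof.
move=> phipsi /asboolP psin; apply/asboolP.
by apply: filterS2 phipsi psin => x ->.
Qed.

Definition integral : {pred X -> rat} := vge 0.

Lemma integralP phi : reflect
  (\forall x \near large_primes X, vp_ge (prime_of x) 0 (phi x))
  (phi \in integral).
Proof. exact: asboolP. Qed.

Lemma integral_mulr_closed : mulr_closed integral.
Proof.
split=> [|phi psi phi0 psi0]; last exact: (vgeM phi0 psi0).
by apply/integralP/nearW => x; apply: (vp_ge0_nat _ 1).
Qed.

HB.instance Definition _ := GRing.ZmodClosed.on integral.
HB.instance Definition _ :=
  GRing.isMulClosed.Build (X -> rat) integral integral_mulr_closed.

Lemma integral_cst (c : rat) : cst c \in integral.
Proof.
apply/integralP; apply: filterS (near_not_dvd X (n := `|denq c|) _) => [x pc|].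
  right; rewrite /vp [logn _ `|denq c|]logn_coprime ?subr0 //.
  by rewrite prime_coprime ?primeTP.
by rewrite absz_gt0 denq_neq0.
Qed.

Definition prime_fun : X -> rat := fun x => (prime_of x)%:R.

Lemma prime_funX_vge (n : nat) : prime_fun ^+ n \in vge n.
Proof.
apply/asboolP/nearW => x; rewrite exprfctE; exact: (vp_ge_prime_exprz _ n).
Qed.

Lemma weighted_hsum_vge c k u : weighted_hsum c k u \o prime_of \in vge k.
Proof.
pose h (x : X) := hsum_nat u (prime_of x).-1.
have h_int : h \in integral.
  apply/integralP/nearW => x; apply: vp_ge0_hsum.
  by rewrite ltn_predL primeT_gt0.
rewrite (_ : _ \o _ = prime_fun ^+ k * (cst c * h)); last first.
  by apply: funext => x; rewrite !fctE /weighted_hsum mulrA [c * _]mulrC.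
rewrite -[Posz k]addr0; apply: vgeM; first exact: prime_funX_vge.
by apply: (rpredM (integral_cst c) h_int).
Qed.

Lemma weighted_mhs_integral C :
  C \in weighted_mhs -> C \o prime_of \in integral.
Proof.
apply: (zspan_morph (f := fun C => C \o prime_of)) => // _ [c [k [u [_ ->]]]].
by apply: vge_le (weighted_hsum_vge c k u).
Qed.

End UniformValuation.
Arguments vge : clear implicits.
Arguments integral : clear implicits.
Arguments prime_fun : clear implicits.

(** * Asymptotic expansions in powers of [p] *)

Definition expandable (X : primeFamily) (S : {pred X -> rat}) :
    {pred X -> rat} :=
  [pred phi | `[< exists2 F : nat -> X -> rat, forall j, F j \in S &
    forall N : nat,
      phi - \sum_(j < N.+1) prime_fun X ^+ j * F j \in vge X N.+1 >]].

Section Expandable.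
Variables (X : primeFamily) (S : zmodClosed (X -> rat)).
Implicit Types (phi psi : X -> rat).

Lemma expandable_zmod_closed : zmod_closed (expandable S).
Proof.
split=> [|phi psi /asboolP[F FS phiE] /asboolP[G GS psiE]]; apply/asboolP.
  exists 0 => [j|N]; first exact: rpred0.
  by rewrite big1 ?subrr ?rpred0 // => j _; rewrite mulr0.
exists (fun j => F j - G j) => [j|N]; first exact: rpredB.
under eq_bigr do rewrite mulrBr.
rewrite sumrB opprD addrACA -opprD; exact: rpredB.
Qed.

Lemma mem_expandable phi : phi \in S -> phi \in expandable S.
Proof.
move=> phiS; apply/asboolP; exists (fun j => if j is 0 then phi else 0).
  by case=> [|j] //; apply: rpred0.
move=> N; rewrite big_ord_recl big1 => [|j _]; last exact: mulr0.
by rewrite expr0 mul1r addr0 subrr rpred0.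
Qed.

Lemma near_eq_expandable phi psi :
  (\forall x \near large_primes X, phi x = psi x) ->
  psi \in expandable S -> phi \in expandable S.
Proof.
move=> phipsi /asboolP[F FS psiE]; apply/asboolP; exists F => // N.
by apply: near_eq_vge (psiE N); apply: filterS phipsi => x; rewrite !fctE => ->.
Qed.

Lemma expandable_integral :
  {subset S <= integral X} -> {subset expandable S <= integral X}.
Proof.
move=> Sint phi /asboolP[F FS /(_ 0%N)]; rewrite big_ord1 expr0 mul1r => phi1.
rewrite -(subrK (F 0%N) phi) rpredD //; first exact: (@vge_le X 0 1).
exact: Sint.
Qed.

End Expandable.

HB.instance Definition _ X (S : zmodClosed (point X -> rat)) :=
  GRing.isZmodClosed.Build (X -> rat) (expandable S) (expandable_zmod_closed S).

Lemma triangular_sum (R : pzRingType) (t : R) (F : nat -> nat -> R) N :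
  \sum_(k < N) t ^+ k * (\sum_(i < k.+1) F i (k - i)%N) =
  \sum_(j < N) t ^+ j * (\sum_(i < N - j) t ^+ i * F j i).
Proof.
elim: N => [|N IH]; first by rewrite !big_ord0.
rewrite big_ord_recr /= {}IH [RHS]big_ord_recr /= subSn // subnn big_ord1.
rewrite big_ord_recr /= subnn mulrDr addrA expr0 mul1r; congr (_ + _).
rewrite mulr_sumr -big_split /=; apply: eq_bigr => j _.
rewrite subSn 1?ltnW // big_ord_recr /= mulrDr; congr (_ + _).
by rewrite mulrA -exprD subnKC // ltnW.
Qed.

Lemma expandable_series (X : primeFamily) (S : zmodClosed (point X -> rat))
    (F : nat -> X -> rat) phi :
  (forall j, F j \in expandable S) ->
  (forall N : nat,
     phi - \sum_(j < N.+1) prime_fun X ^+ j * F j \in vge X N.+1) ->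
  phi \in expandable S.
Proof.
move=> FS phiE.
have /choice[H HP] : forall j, exists G : nat -> X -> rat,
    (forall i, G i \in S) /\ forall N : nat,
      F j - \sum_(i < N.+1) prime_fun X ^+ i * G i \in vge X N.+1.
  by move=> j; have /asboolP[G] := FS j; exists G.
apply/asboolP; exists (fun k => \sum_(i < k.+1) H i (k - i)%N) => [k|N].
  by apply: rpred_sum => i _; have [] := HP i.
rewrite (triangular_sum _ H).
rewrite -(subrK (\sum_(j < N.+1) prime_fun X ^+ j * F j) phi).
rewrite -addrA -sumrB; apply: rpredD => //; apply: rpred_sum => j _.
have jN : (j <= N)%N by rewrite -ltnS.
rewrite -mulrBr (_ : Posz N.+1 = j%:Z + (N - j).+1); last first.
  by rewrite -PoszD addnS subnKC.
apply: vgeM; first exact: prime_funX_vge.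
by rewrite subSn //; have [] := HP j.
Qed.

Section WeightedSum.
Variables (X Y : primeFamily) (n : Y -> nat) (w : Y -> nat -> rat).
Variable (pt : Y -> nat -> X).

Definition weighted_sum (phi : X -> rat) (y : Y) : rat :=
  \sum_(k < n y) w y k * phi (pt y k).

Hypothesis pt_prime : forall y k, prime_of (pt y k) = prime_of y.
Hypothesis near_dom_integral : \forall y \near large_primes Y,
  forall k, (k < n y)%N -> dom (pt y k) /\ vp_ge (prime_of y) 0 (w y k).

Lemma weighted_sum_zmod_morphism : zmod_morphism weighted_sum.
Proof.
move=> phi psi; apply: funext => y; rewrite !fctE /weighted_sum -sumrB.
by apply: eq_bigr => k _; rewrite -mulrBr.
Qed.

HB.instance Definition _ := GRing.isZmodMorphism.Build (X -> rat) (Y -> rat)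
  weighted_sum weighted_sum_zmod_morphism.

Lemma weighted_sum_comp (C : primeT -> rat) phi :
  weighted_sum ((C \o prime_of) * phi) = (C \o prime_of) * weighted_sum phi.
Proof.
apply: funext => y; rewrite !fctE /weighted_sum mulr_sumr.
by apply: eq_bigr => k _; rewrite pt_prime mulrCA.
Qed.

Lemma weighted_sum_vge m phi : phi \in vge X m -> weighted_sum phi \in vge Y m.
Proof.
move=> /asboolP[M phim]; apply/asboolP.
have large_p : \forall y \near large_primes Y, (M <= prime_of y)%N by exists M.
apply: filterS2 near_dom_integral large_p => y near_y My.
apply: vp_ge_sum => k _; have [dom_k wk] := near_y k (ltn_ord k).
rewrite -[m]add0r; apply: vp_geM => //.
by rewrite -(pt_prime y k); apply: phim; rewrite ?pt_prime.
Qed.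

Lemma expandable_weighted_sum (S : zmodClosed (point X -> rat))
    (T : zmodClosed (point Y -> rat)) phi :
  (forall psi, psi \in S -> weighted_sum psi \in expandable T) ->
  phi \in expandable S -> weighted_sum phi \in expandable T.
Proof.
move=> ST /asboolP[F FS phiE].
apply: (expandable_series (F := fun j => weighted_sum (F j))) => [j|N].
  exact: ST.
have := weighted_sum_vge (phiE N); congr (_ \in vge Y _).
rewrite raddfB raddf_sum; congr (_ - _); apply: eq_bigr => j _.
have powE (Z : primeFamily) : prime_fun Z ^+ j =
  (fun p : primeT => p%:R ^+ j : rat) \o prime_of by rewrite exprfctE.
by rewrite (powE X) (powE Y) -weighted_sum_comp.
Qed.

End WeightedSum.

Section MhsSpan.
Variables (X : primeFamily) (I : Type) (b : I -> X -> rat).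

Definition mhs_span : {pred X -> rat} := zspan
  [set phi | exists C i, C \in weighted_mhs /\ phi = (C \o prime_of) * b i].

HB.instance Definition _ := GRing.ZmodClosed.on mhs_span.

Lemma mem_mhs_span C i :
  C \in weighted_mhs -> (C \o prime_of) * b i \in mhs_span.
Proof. by move=> CM; apply: mem_zspan; exists C, i. Qed.

Lemma mhs_span_gen i : b i \in mhs_span.
Proof. by rewrite -[b i]mul1r; apply: (@mem_mhs_span 1 i (rpred1 _)). Qed.

Lemma mhs_span_integral :
  (forall i, b i \in integral X) -> {subset mhs_span <= integral X}.
Proof.
move=> b_int; apply: (zspan_morph (f := id)) => // _ [C [i [CM ->]]].
by rewrite rpredM ?weighted_mhs_integral.
Qed.

Lemma expandable_mhs_spanM C phi : C \in weighted_mhs ->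
  phi \in expandable mhs_span -> (C \o prime_of) * phi \in expandable mhs_span.
Proof.
move=> CM /asboolP[F FS phiE]; apply/asboolP.
exists (fun j => (C \o prime_of) * F j) => [j|N].
  apply: zspan_morph (FS j) => [g h|_ [D [i [DM ->]]]]; first exact: mulrBr.
  by rewrite mulrA; apply: (@mem_mhs_span (C * D)); apply: rpredM.
under eq_bigr do rewrite mulrCA; rewrite -mulr_sumr -mulrBr -[Posz N.+1]add0r.
by apply: vgeM => //; apply: weighted_mhs_integral.
Qed.

End MhsSpan.

Local Notation mhs_expandable b := (expandable (mhs_span b)).

Lemma mhs_expandable_gen (X : primeFamily) (I : Type) (b : I -> X -> rat) i :
  b i \in mhs_expandable b.
Proof. exact/mem_expandable/mhs_span_gen. Qed.

Lemma mhs_expandable_weighted_sum (X Y : primeFamily) (n : Y -> nat)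
    (w : Y -> nat -> rat) (pt : Y -> nat -> X)
    (I J : Type) (b : I -> X -> rat) (c : J -> Y -> rat) phi :
  (forall y k, prime_of (pt y k) = prime_of y) ->
  (\forall y \near large_primes Y,
     forall k, (k < n y)%N -> dom (pt y k) /\ vp_ge (prime_of y) 0 (w y k)) ->
  (forall i, weighted_sum n w pt (b i) \in mhs_expandable c) ->
  phi \in mhs_expandable b -> weighted_sum n w pt phi \in mhs_expandable c.
Proof.
move=> pt_prime near_int bc; apply: expandable_weighted_sum => // psi.
apply: zspan_morph => [|_ [C [i [CM ->]]]]; first exact: raddfB.
by rewrite weighted_sum_comp //; apply: expandable_mhs_spanM.
Qed.

Lemma mhs_expandable_pullback (X Y : primeFamily) (pt : Y -> X)
    (I J : Type) (b : I -> X -> rat) (c : J -> Y -> rat) phi :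
  (forall y, prime_of (pt y) = prime_of y) ->
  (\forall y \near large_primes Y, dom (pt y)) ->
  (forall i, b i \o pt \in mhs_expandable c) ->
  phi \in mhs_expandable b -> phi \o pt \in mhs_expandable c.
Proof.
move=> pt_prime pt_dom bc.
have comp_sum psi : psi \o pt = weighted_sum (fun=> 1%N) (fun _ _ => 1)
    (fun y _ => pt y) psi.
  by apply: funext => y; rewrite /weighted_sum big_ord1 mul1r.
rewrite comp_sum; apply: mhs_expandable_weighted_sum => // [|i].
  by apply: filterS pt_dom => y dy k _; split=> //; apply: (vp_ge0_nat _ 1).
by rewrite -comp_sum.
Qed.

Lemma integral_mul_mhs_expandable (X : primeFamily) (I J : Type)
    (b : I -> X -> rat) (c : J -> X -> rat) phi psi :
  phi \in integral X -> (forall i, phi * b i \in mhs_expandable c) ->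
  psi \in mhs_expandable b -> phi * psi \in mhs_expandable c.
Proof.
move=> /integralP phi_int bc psib.
have mul_sum f : phi * f =
    weighted_sum (fun=> 1%N) (fun x _ => phi x) (fun x _ => x) f.
  by apply: funext => x; rewrite /weighted_sum big_ord1.
rewrite mul_sum; apply: mhs_expandable_weighted_sum psib => // [|i].
  by apply: filterS2 (near_dom X) phi_int => x.
by rewrite -mul_sum.
Qed.

Lemma mhs_expandableM (X : primeFamily) (I J K : Type)
    (b : I -> X -> rat) (c : J -> X -> rat) (e : K -> X -> rat) phi psi :
  (forall i, b i \in integral X) -> (forall j, c j \in integral X) ->
  (forall i j, b i * c j \in mhs_expandable e) ->
  phi \in mhs_expandable b -> psi \in mhs_expandable c ->
  phi * psi \in mhs_expandable e.
Proof.
move=> b_int c_int bc phib; apply: integral_mul_mhs_expandable => [|j].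
  by apply: expandable_integral phib; apply: mhs_span_integral.
rewrite mulrC; apply: integral_mul_mhs_expandable phib => // i.
by rewrite mulrC.
Qed.

Lemma geometric_remainder (R : comPzRingType) (t y u v : R) N :
  v = u + t * y * u * v ->
  v - \sum_(j < N) t ^+ j * (y ^+ j * u ^+ j.+1) =
  t ^+ N * (y ^+ N * u ^+ N * v).
Proof.
move=> vE; elim: N => [|N IH]; first by rewrite big_ord0 subr0 !mul1r.
rewrite big_ord_recr opprD addrA {}IH [in LHS]vE /= !mulrDr.
rewrite -[y ^+ N * u ^+ N * u]mulrA -exprSr addrAC subrr add0r.
by rewrite !exprSr; ring.
Qed.

Lemma expandable_geometric (X : primeFamily) (S : zmodClosed (point X -> rat))
    (u v y : X -> rat) :
  u \in integral X -> v \in integral X -> y \in integral X ->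
  (\forall x \near large_primes X,
     v x = u x + (prime_of x)%:R * y x * u x * v x) ->
  (forall j, y ^+ j * u ^+ j.+1 \in S) ->
  v \in expandable S.
Proof.
move=> u_int v_int y_int vE yuS; apply/asboolP.
exists (fun j => y ^+ j * u ^+ j.+1) => // N.
have rest_int : y ^+ N.+1 * u ^+ N.+1 * v \in integral X.
  by rewrite !rpredM ?rpredX.
have := vgeM (prime_funX_vge _ N.+1) rest_int; rewrite addr0.
apply: near_eq_vge; apply: filterS vE => x vxE; rewrite fct_sumE !fctE.
rewrite -(geometric_remainder _ vxE); congr (_ - _).
by apply: eq_bigr => j _; rewrite !fctE.
Qed.

(** * Sums over one block of length [p] *)

(* [restricted] selects the sums over indices prime to [p]. *)
Definition ripow (restricted : bool) (p : nat) (a : int) (n : nat) : rat :=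
  if restricted && (p %| n.+1)%N then 0 else ipow a n.

Local Notation rhsum restricted p := (nsum (ripow restricted p)).

Lemma ripowD r p a b n : ripow r p a n * ripow r p b n = ripow r p (a + b) n.
Proof. by rewrite /ripow; case: ifP => _; rewrite ?mul0r ?ipowD. Qed.

Lemma ripowX r p n k : ripow r p 1 n ^+ k.+1 = ripow r p k.+1%:Z n.
Proof.
elim: k => [//|k IH]; rewrite exprSr IH ripowD.
by rewrite [k.+2%:Z]intS [1 + _]addrC.
Qed.

Lemma vp_ge0_ripow (p : primeT) a n : vp_ge p 0 (ripow true p a n).
Proof.
rewrite /ripow; case: ifP => [_|/negbT]; first exact: vp_ge0.
exact: (@vp_ge0_exprz p n.+1).
Qed.

Lemma dvdn_addS p m n : (p %| m)%N -> (p %| (m + n).+1)%N = (p %| n.+1)%N.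
Proof. by move=> pm; rewrite -addnS dvdn_addr. Qed.

Lemma nsum_ripow_pred (p : primeT) r s m : (p %| m)%N ->
  nsum (fun a n => ripow r p a (m + n)%N) s p.-1 =
  nsum (fun a n => ripow true p a (m + n)%N) s p.
Proof.
move=> pm; have p0 := primeT_gt0 p.
transitivity (nsum (fun a n => ripow true p a (m + n)%N) s p.-1).
  apply: eq_nsum => a n np; rewrite /ripow (dvdn_addS _ pm) gtnNdvd ?andbF //.
  by rewrite -ltn_predRL.
case: s => // a s; rewrite -[X in _ = nsum _ _ X](prednK p0) nsumS.
by rewrite [X in _ + X * _]/ripow (dvdn_addS _ pm) prednK // dvdnn mul0r addr0.
Qed.

Lemma rhsum_prime (p : primeT) s : rhsum true p s p = hsum s p.-1.
Proof. by rewrite -(nsum_ripow_pred false s (dvdn0 p)). Qed.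

(* The point [(p, (i, n))] stands for the number [p * i + n.+1]. *)
Definition block_family : primeFamily := pairs_family (fun=> @setT (nat * nat)).

Definition block_ipow (a : int) (x : block_family) : rat :=
  ripow true x.1 a (x.1 * x.2.1 + x.2.2).

Definition block_hsum (s : seq int) (x : block_family) : rat :=
  nsum (fun a n => ripow true x.1 a (x.1 * x.2.1 + n)) s x.2.2.

Definition offset_ipow (t : nat * int) (x : block_family) : rat :=
  x.2.1%:R ^+ t.1 * ripow true x.1 t.2 x.2.2.

Definition offset_hsum (t : nat * seq int) (x : block_family) : rat :=
  x.2.1%:R ^+ t.1 * rhsum true x.1 t.2 x.2.2.

Lemma offset_ipow_integral t : offset_ipow t \in integral block_family.
Proof.
apply/integralP/nearW => x; apply: vp_ge0M; last exact: vp_ge0_ripow.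
exact/vp_ge0X/vp_ge0_nat.
Qed.

Lemma offset_hsum_integral t : offset_hsum t \in integral block_family.
Proof.
apply/integralP/nearW => x; apply: vp_ge0M; first exact/vp_ge0X/vp_ge0_nat.
by apply: vp_ge0_nsum => a n _; apply: vp_ge0_ripow.
Qed.

Lemma block_ipowD a b : block_ipow (a + b) = block_ipow a * block_ipow b.
Proof. by apply: funext => x; rewrite !fctE /block_ipow ripowD. Qed.

Lemma offset_ipow_expandableM phi psi :
  phi \in mhs_expandable offset_ipow -> psi \in mhs_expandable offset_ipow ->
  phi * psi \in mhs_expandable offset_ipow.
Proof.
apply: mhs_expandableM; try exact: offset_ipow_integral.
move=> [a e] [b f]; rewrite (_ : _ * _ = offset_ipow ((a + b)%N, e + f)).
  exact: mhs_expandable_gen.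
by apply: funext => x; rewrite !fctE /offset_ipow /= -ripowD exprD; ring.
Qed.

Lemma block_ipow0_expandable : block_ipow 0 \in mhs_expandable offset_ipow.
Proof.
rewrite (_ : block_ipow 0 = offset_ipow (0%N, 0)).
  exact: mhs_expandable_gen.
apply: funext => x.
by rewrite /block_ipow /offset_ipow mul1r /ripow dvdn_addS ?dvdn_mulr //.
Qed.

Lemma block_ipowN1_expandable : block_ipow (-1) \in mhs_expandable offset_ipow.
Proof.
have -> : block_ipow (-1) = offset_ipow (0%N, -1) +
    ((fun p : primeT => p%:R) \o prime_of) * offset_ipow (1%N, 0).
  apply: funext => x; rewrite !fctE /block_ipow /offset_ipow /= mul1r expr1.
  rewrite /ripow dvdn_addS ?dvdn_mulr //; case: ifP => _.
    by rewrite !mulr0 addr0.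
  by rewrite /ipow !opprK oppr0 mulr1 -addnS natrD natrM addrC.
apply/mem_expandable/rpredD; first exact: mhs_span_gen.
by apply: mem_mhs_span; apply: weighted_mhs_prime.
Qed.

Lemma block_ipow1_expandable : block_ipow 1 \in mhs_expandable offset_ipow.
Proof.
pose y (x : block_family) : rat := - x.2.1%:R.
apply: (expandable_geometric (u := offset_ipow (0%N, 1)) (y := y)).
- exact: offset_ipow_integral.
- by apply/integralP/nearW => x; apply: vp_ge0_ripow.
- by rewrite rpredN; apply/integralP/nearW => x; apply: vp_ge0_nat.
- apply: nearW => x; rewrite /block_ipow /offset_ipow /y /= mul1r.
  rewrite /ripow dvdn_addS ?dvdn_mulr //; case: ifP => _.
    by rewrite !mulr0 addr0.
  have term_neq0 : (x.1 * x.2.1 + x.2.2).+1%:R != 0 :> rat by rewrite pnatr_eq0.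
  have offset_neq0 : x.2.2.+1%:R != 0 :> rat by rewrite pnatr_eq0.
  move: offset_neq0 term_neq0; rewrite /ipow !exprN1 -addnS natrD natrM.
  move: (x.2.2.+1%:R) => t t0 term_neq0.
  by field; rewrite t0 term_neq0.
move=> j; rewrite (_ : _ * _ = (cst ((-1) ^+ j) \o prime_of) *
  offset_ipow (j, j.+1%:Z)).
  exact/mem_mhs_span/weighted_mhs_cst.
apply: funext => x; rewrite !fctE /offset_ipow /y /= mul1r ripowX.
by rewrite [in LHS]exprNn mulrA.
Qed.

Lemma block_ipow_expandable a : block_ipow a \in mhs_expandable offset_ipow.
Proof.
elim/int_ind: a => [|n IH|n IH]; first exact: block_ipow0_expandable.
  rewrite intS block_ipowD.
  exact: offset_ipow_expandableM block_ipow1_expandable IH.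
rewrite intS opprD block_ipowD.
exact: offset_ipow_expandableM block_ipowN1_expandable IH.
Qed.

Lemma block_hsum_expandable s : block_hsum s \in mhs_expandable offset_hsum.
Proof.
elim: s => [|a s IH].
  rewrite (_ : block_hsum [::] = offset_hsum (0%N, [::])).
    exact: mhs_expandable_gen.
  by apply: funext => x; rewrite /offset_hsum mulr1.
pose prod (t : nat * int * seq int) (x : block_family) : rat :=
  x.2.1%:R ^+ t.1.1 * ripow true x.1 t.1.2 x.2.2 * rhsum true x.1 t.2 x.2.2.
have -> : block_hsum (a :: s) = weighted_sum (X := block_family)
    (fun x : block_family => x.2.2) (fun _ _ => 1)
    (fun x n => (x.1, (x.2.1, n))) (block_ipow a * block_hsum s).
  by apply: funext => x; apply: eq_bigr => n _; rewrite mul1r.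
apply: (mhs_expandable_weighted_sum (b := prod)) => // [|[[i e] t]|].
- by apply: nearW => x n _; split=> //; apply: (vp_ge0_nat _ 1).
- rewrite (_ : weighted_sum _ _ _ _ = offset_hsum (i, e :: t)).
    exact: mhs_expandable_gen.
  apply: funext => x; rewrite /offset_hsum /= mulr_sumr.
  by apply: eq_bigr => n _; rewrite mul1r mulrA.
apply: mhs_expandableM (block_ipow_expandable a) IH.
- exact: offset_ipow_integral.
- exact: offset_hsum_integral.
move=> [i e] [j t]; rewrite (_ : _ * _ = prod ((i + j)%N, e, t)).
  exact: mhs_expandable_gen.
apply: funext => x; rewrite !fctE /offset_ipow /offset_hsum /prod /= exprD.
by ring.
Qed.

Definition full_block_hsum (s : seq int) (x : primeT * nat) : rat :=
  block_hsum s (x.1, (x.2, x.1 : nat)).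

Lemma full_block_hsum_expandable D s :
  full_block_hsum s \in
    mhs_expandable (fun e (x : pairs_family D) => x.2%:R ^+ e).
Proof.
apply: (mhs_expandable_pullback (pt := fun x : pairs_family D =>
  ((x.1, (x.2, x.1 : nat)) : block_family))) (block_hsum_expandable s) => //.
  exact: nearW.
move=> [e t]; apply: mem_expandable.
rewrite (_ : _ \o _ = ((fun p : primeT => hsum t p.-1) \o prime_of) *
  (fun x : pairs_family D => x.2%:R ^+ e)).
  exact: (mem_mhs_span _ _ (weighted_mhs_hsum t)).
apply: funext => x; rewrite !fctE /offset_hsum /= mulrC.
by rewrite rhsum_prime.
Qed.

(** * Sums up to a multiple of [p] *)

Definition pos_nat (a : int) : nat := if a is Posz n then n else 0.

Lemma pos_natB a (l : nat) : (pos_nat (a - l%:Z) <= pos_nat a)%N.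
Proof. by case: a => n; rewrite /pos_nat; case E: (_ - _) => [m|m] //; lia. Qed.

Definition clear_exp (restricted : bool) (d : nat) (a : int) : nat :=
  if restricted then 0 else (d * pos_nat a)%N.

(* The factor [p ^+ clear_exp] makes the term integral for [n.+1 < p ^ d.+1]. *)
Definition cleared_ipow (restricted : bool) (d p : nat) (a : int) (n : nat) :
    rat :=
  p%:R ^+ clear_exp restricted d a * ripow restricted p a n.

Local Notation cleared_hsum restricted d p :=
  (nsum (cleared_ipow restricted d p)).

Lemma cleared_ipow0 d p n : cleared_ipow false d p 0 n = 1.
Proof. by rewrite /cleared_ipow /= muln0 mul1r. Qed.

Lemma vp_ge0_cleared_ipow (p : primeT) r d a n :
  (n.+1 < p ^ d.+1)%N -> vp_ge p 0 (cleared_ipow r d p a n).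
Proof.
move=> nd; rewrite /cleared_ipow; case: r.
  by rewrite mul1r; apply: vp_ge0_ripow.
rewrite /ripow /ipow /=; case: a => a; last first.
  by rewrite NegzE opprK; apply: vp_ge0M; apply/vp_ge0X/vp_ge0_nat.
rewrite exprM -invr_expz -exprnP -exprVn -exprMn; apply: vp_ge0X.
apply: (@vp_ge_le _ _ (d%:Z - (logn p n.+1)%:Z)); last first.
  by apply: vp_geM; [exact: (vp_ge_prime_exprz p d)|exact: (@vp_ge_inv p n.+1)].
rewrite subr_ge0 lez_nat -ltnS -(ltn_exp2l _ _ (prime_gt1 (primeTP p))).
by apply: leq_ltn_trans nd; apply/dvdn_leq/pfactor_dvdnn.
Qed.

(* The power of [p] left on clearing the denominator of [(p * i.+1) ^ - a]. *)
Definition multiple_factor (restricted : bool) (a : int) (p : primeT) : rat :=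
  if restricted then 0 else p%:R ^+ pos_nat (- a).

Lemma multiple_factor_mhs r a : multiple_factor r a \in weighted_mhs.
Proof.
rewrite /multiple_factor; case: r; first exact: rpred0.
exact: weighted_mhs_primeX.
Qed.

Lemma cleared_ipow_multiple (p : primeT) r d a i :
  cleared_ipow r d.+1 p a (p * i + p.-1) =
  multiple_factor r a p * cleared_ipow false d p a i.
Proof.
have p0 := natr_primeT_neq0 p.
have i0 : i.+1%:R != 0 :> rat by rewrite pnatr_eq0.
have pred_succ : (p * i + p.-1).+1 = (p * i.+1)%N.
  by rewrite -addnS prednK ?mulnS 1?addnC // primeT_gt0.
rewrite /multiple_factor /cleared_ipow /ripow /ipow.
rewrite pred_succ dvdn_mulr // andbT.
case: r => /=; first by rewrite mulr0 mul0r.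
rewrite natrM exprzMl ?unitfE // !mulrA; congr (_ * _).
rewrite -exprD !exprnP -expfzDr //; congr (_ ^ _).
by case: a => [[|m]|m]; rewrite /= ?NegzE ?opprK /=; lia.
Qed.

Definition below_power (d : nat) : primeFamily :=
  pairs_family (fun p m => (m < p ^ d.+1)%N).

Definition cleared_block (restricted : bool) (d : nat) (s : seq int)
    (x : below_power d) : rat :=
  x.1%:R ^+ (\sum_(a <- s) clear_exp restricted d.+1 a) * full_block_hsum s x.
Arguments cleared_block : clear implicits.

Lemma nsum_cleared_block (p : primeT) r d a s i :
  nsum (fun a n => cleared_ipow r d.+1 p a (p * i + n)) (a :: s) p =
  cleared_block r d (a :: s) (p, i) +
  multiple_factor r a p * cleared_ipow false d p a i *
    cleared_block r d s (p, i).
Proof.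
have cleared_pred t :
    nsum (fun a n => cleared_ipow r d.+1 p a (p * i + n)) t p.-1 =
    cleared_block r d t (p, i).
  by rewrite nsum_scale prodrXr nsum_ripow_pred // dvdn_mulr.
rewrite -[X in nsum _ _ X = _](prednK (primeT_gt0 p)) nsumS.
by rewrite !cleared_pred cleared_ipow_multiple.
Qed.

Definition cleared_basis d (s : seq int) (x : below_power d) : rat :=
  cleared_hsum false d x.1 s x.2.
Arguments cleared_basis : clear implicits.

Lemma cleared_basis_integral d s :
  cleared_basis d s \in integral (below_power d).
Proof.
apply/integralP; apply: filterS (near_dom _) => x dx.
apply: vp_ge0_nsum => a n nx.
by apply: vp_ge0_cleared_ipow; apply: leq_ltn_trans dx.
Qed.

Lemma cleared_ipowB p d a n l : n.+1%:R ^+ l * cleared_ipow false d p a n =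
  p%:R ^+ (d * (pos_nat a - pos_nat (a - l%:Z))) *
  cleared_ipow false d p (a - l%:Z) n.
Proof.
rewrite /cleared_ipow [RHS]mulrA -exprD /= -mulnDr subnK ?pos_natB //.
by rewrite /ripow /= -ipowD ipowN; ring.
Qed.

Definition sum_cleared_ipow d a (phi : below_power d -> rat) :
    below_power d -> rat :=
  weighted_sum (X := below_power d) (fun x : below_power d => x.2)
    (fun x => cleared_ipow false d x.1 a) (fun x n => (x.1, n)) phi.

Lemma sum_cleared_ipow_basis d a k s :
  sum_cleared_ipow a (fun x => x.2%:R ^+ k * cleared_basis d s x)
    \in mhs_expandable (cleared_basis d).
Proof.
pose powp l (p : primeT) : rat :=
  pred_coef k l * p%:R ^+ (d * (pos_nat a - pos_nat (a - l%:Z))).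
have -> : sum_cleared_ipow a (fun x => x.2%:R ^+ k * cleared_basis d s x) =
    \sum_(l < k.+1) (powp l \o prime_of) * cleared_basis d (a - l%:Z :: s).
  apply: funext => x; rewrite fct_sumE /sum_cleared_ipow /weighted_sum.
  under [RHS]eq_bigr do rewrite fctE /cleared_basis nsum_cons mulr_sumr.
  rewrite exchange_big; apply: eq_bigr => n _.
  rewrite expr_pred mulr_suml mulr_sumr; apply: eq_bigr => l _.
  have := cleared_ipowB x.1 d a n l; rewrite /powp /cleared_basis /=.
  move: (cleared_ipow _ _ _ a _) (cleared_ipow _ _ _ (a - _) _) (nsum _ s n).
  by move=> y z h shiftE; ring: shiftE.
apply/mem_expandable/rpred_sum => l _; apply: mem_mhs_span.
apply: rpredM; first exact: weighted_mhs_cst.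
exact: weighted_mhs_primeX.
Qed.

Lemma sum_cleared_ipow_expandable d a phi psi :
  phi \in mhs_expandable (fun k (x : below_power d) => x.2%:R ^+ k) ->
  psi \in mhs_expandable (cleared_basis d) ->
  sum_cleared_ipow a (phi * psi) \in mhs_expandable (cleared_basis d).
Proof.
pose prod (t : nat * seq int) (x : below_power d) : rat :=
  x.2%:R ^+ t.1 * cleared_basis d t.2 x.
move=> phiE psiE.
apply: (mhs_expandable_weighted_sum (b := prod)) => // [|[k s]|].
- apply: filterS (near_dom _) => x dx n nx; split; first exact: ltn_trans dx.
  by apply: vp_ge0_cleared_ipow; apply: leq_ltn_trans dx.
- exact: sum_cleared_ipow_basis.
apply: mhs_expandableM phiE psiE => [k|s|k s].
- by apply/integralP/nearW => x; apply/vp_ge0X/vp_ge0_nat.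
- exact: cleared_basis_integral.
exact: (mhs_expandable_gen prod (k, s)).
Qed.

Definition cleared_hsum_mulp r d s (x : below_power d) : rat :=
  cleared_hsum r d.+1 x.1 s (x.1 * x.2).
Arguments cleared_hsum_mulp : clear implicits.

Lemma cleared_hsum_mulp_cons r d a s : cleared_hsum_mulp r d (a :: s) =
  \sum_(k < (size s).+1)
    (sum_cleared_ipow 0
       (cleared_block r d (a :: take k s) * cleared_hsum_mulp r d (drop k s)) +
     (multiple_factor r a \o prime_of) * sum_cleared_ipow a
       (cleared_block r d (take k s) * cleared_hsum_mulp r d (drop k s))).
Proof.
apply: funext => x.
rewrite fct_sumE /cleared_hsum_mulp nsum_blocks exchange_big.
apply: eq_bigr => k _; rewrite !fctE /sum_cleared_ipow /weighted_sum mulr_sumr.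
rewrite -big_split; apply: eq_bigr => i _.
by rewrite nsum_cleared_block mulrDl !mulrA cleared_ipow0 mul1r.
Qed.

Lemma cleared_hsum_mulp_expandable r d s :
  cleared_hsum_mulp r d s \in mhs_expandable (cleared_basis d).
Proof.
have [n] := ubnP (size s); elim: n s => // n IH [|a s] size_s.
  exact: (mhs_expandable_gen (cleared_basis d) [::]).
have blockE t : cleared_block r d t \in
    mhs_expandable (fun k (x : below_power d) => x.2%:R ^+ k).
  pose powp (p : primeT) : rat := p%:R ^+ (\sum_(b <- t) clear_exp r d.+1 b).
  apply: (@expandable_mhs_spanM _ _ _ powp); first exact: weighted_mhs_primeX.
  exact: full_block_hsum_expandable.
have tailE k :
    cleared_hsum_mulp r d (drop k s) \in mhs_expandable (cleared_basis d).
  by apply: IH; rewrite size_drop; move: size_s => /=; lia.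
rewrite cleared_hsum_mulp_cons; apply: rpred_sum => k _; apply: rpredD.
  exact: sum_cleared_ipow_expandable.
apply: expandable_mhs_spanM; first exact: multiple_factor_mhs.
exact: sum_cleared_ipow_expandable.
Qed.

(** * Polynomials in [p] *)

Definition one_basis (_ : unit) : primes_family -> rat := 1.

Definition mhs_series : {pred primeT -> rat} := mhs_expandable one_basis.

Lemma one_basis_integral t : one_basis t \in integral primes_family.
Proof. exact: rpred1. Qed.

Lemma mhs_series_integral : {subset mhs_series <= integral primes_family}.
Proof. exact: (expandable_integral (mhs_span_integral one_basis_integral)). Qed.

Lemma mhs_series_mulr_closed : mulr_closed mhs_series.
Proof.
have one_mem : (1 : primeT -> rat) \in mhs_series.
  exact: (mhs_expandable_gen one_basis tt).
split=> // phi psi.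
apply: (mhs_expandableM one_basis_integral one_basis_integral).
by move=> i j; rewrite [_ * _]mulr1.
Qed.

HB.instance Definition _ := GRing.isZmodClosed.Build (primeT -> rat) mhs_series
  (expandable_zmod_closed (mhs_span one_basis)).
HB.instance Definition _ :=
  GRing.isMulClosed.Build (primeT -> rat) mhs_series mhs_series_mulr_closed.

Lemma eq_mhs_series phi psi : almost_all_primes (fun p => phi p = psi p) ->
  psi \in mhs_series -> phi \in mhs_series.
Proof. by move=> /near_primesP; apply: near_eq_expandable. Qed.

Lemma mem_mhs_span_one_basis : mhs_span one_basis =i weighted_mhs.
Proof.
move=> phi; apply/idP/idP => [|phiM]; last first.
  by rewrite -[phi]mulr1; apply: (mem_mhs_span one_basis tt phiM).
apply: (zspan_morph (f := id)) => // _ [C [i [CM ->]]].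
by rewrite [_ * _]mulr1.
Qed.

Lemma weighted_mhs_series C : C \in weighted_mhs -> C \in mhs_series.
Proof. by move=> CM; apply: mem_expandable; rewrite mem_mhs_span_one_basis. Qed.

Definition horner_prime (f : {poly int}) (p : primeT) : rat := f.[p%:Z]%:~R.

Lemma horner_prime_mhs f : horner_prime f \in weighted_mhs.
Proof.
rewrite (_ : horner_prime f = fun p => (map_poly intr f).[p%:R]).
  exact: weighted_mhs_poly.
by apply: funext => p; rewrite -[p%:R]/(p%:Z%:~R) horner_map.
Qed.

Lemma poly_drop1E (R : nzRingType) (f : {poly R}) :
  f = drop_poly 1 f * 'X + (f`_0)%:P.
Proof.
rewrite -{1}[f](poly_take_drop 1) addrC expr1; congr (_ + _).
by rewrite /take_poly poly_def big_ord1 expr0 alg_polyC.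
Qed.

Lemma dvdz_horner_coef0 (f : {poly int}) (a : int) :
  (a %| f.[a])%Z = (a %| f`_0)%Z.
Proof.
by rewrite [in LHS](poly_drop1E f) hornerD hornerMX hornerC rpredDl ?dvdz_mull.
Qed.

Lemma not_dvdz_horner_prime (f : {poly int}) : f`_0 != 0 ->
  almost_all_primes (fun p => ~~ (p%:Z %| f.[p%:Z])%Z).
Proof.
rewrite -absz_gt0 => /(near_not_dvd primes_family)/near_primesP.
by apply: filterS => p; rewrite dvdz_horner_coef0.
Qed.

Lemma horner_prime_inv_series (g : {poly int}) :
  g`_0 != 0 -> (fun p => (horner_prime g p)^-1) \in mhs_series.
Proof.
move=> g0; pose c : rat := (g`_0)%:~R.
have c0 : c != 0 by rewrite intr_eq0.
pose y : primeT -> rat := cst (-1) * horner_prime (drop_poly 1 g).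
have y_mhs : y \in weighted_mhs.
  by rewrite rpredM ?weighted_mhs_cst ?horner_prime_mhs.
apply: (expandable_geometric (X := primes_family) (u := cst c^-1) (y := y)).
- exact: integral_cst.
- apply/integralP/near_primesP.
  apply: filterS (not_dvdz_horner_prime g0) => p pg.
  exact: (vp_ge0_exprz (-1) pg).
- exact: (weighted_mhs_integral primes_family y_mhs).
- apply/near_primesP; apply: filterS (not_dvdz_horner_prime g0) => p pg.
  have gp0 : horner_prime g p != 0.
    by rewrite intr_eq0; apply: contraNneq pg => ->; rewrite rpred0.
  have gE : horner_prime g p = p%:R * horner_prime (drop_poly 1 g) p + c.
    rewrite {1}/horner_prime [in LHS](poly_drop1E g) hornerD hornerMX hornerC.
    by rewrite intrD intrM mulrC.
  by rewrite /y /= !fctE gE; rewrite gE in gp0; field; rewrite gp0 c0.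
by move=> j; rewrite mem_mhs_span_one_basis rpredM ?rpredX ?weighted_mhs_cst.
Qed.

Lemma horner_prime_quot_series d (g : {poly int}) :
  g != 0 -> (size g <= d.+1)%N ->
  (fun p : primeT => p%:R ^+ d / horner_prime g p) \in mhs_series.
Proof.
elim: d g => [|d IH] g g_neq0 size_g;
  have [g0|/horner_prime_inv_series] := eqVneq g`_0 0.
- by move: g_neq0; rewrite (size1_polyC size_g) g0 eqxx.
- by congr (_ \in mhs_series); apply: funext => p; rewrite expr0 mul1r.
- have gE := poly_drop1E g; rewrite g0 addr0 in gE.
  have drop_neq0 : drop_poly 1 g != 0.
    by apply: contraNneq g_neq0 => h0; rewrite gE h0 mul0r.
  have := IH _ drop_neq0; rewrite size_drop_poly leq_subLR add1n => /(_ size_g).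
  congr (_ \in mhs_series); apply: funext => p.
  have p0 := natr_primeT_neq0 p.
  rewrite {2}/horner_prime [in RHS]gE hornerMX intrM exprS invfM mulrCA.
  by rewrite [_ * _ / _]mulrAC divff // mul1r mulrC.
- by apply: rpredM; apply/weighted_mhs_series/weighted_mhs_primeX.
Qed.

Lemma ripow_series a (N : primeT -> nat) (g : {poly int}) :
  almost_all_primes (fun p => (N p).+1%:Z = g.[p%:Z]) ->
  (fun p : primeT => ripow true p a (N p)) \in mhs_series.
Proof.
move=> NE; have [g0|g0] := eqVneq g`_0 0.
  apply: eq_mhs_series (rpred0 _); apply: filterS NE => p NpE.
  rewrite /ripow -[(_ %| _)%N]/(p%:Z %| (N p).+1%:Z)%Z NpE.
  by rewrite dvdz_horner_coef0 g0 dvdz0.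
have ripowE : almost_all_primes (fun p =>
    ripow true p a (N p) = horner_prime g p ^ (- a)).
  apply: filterS2 NE (not_dvdz_horner_prime g0) => p.
  by rewrite /horner_prime => <- /negPf pN; rewrite /ripow [(_ %| _)%N]pN.
apply: eq_mhs_series ripowE _; case: a => k.
  have := rpredX k (horner_prime_inv_series g0); rewrite exprfctE.
  by congr (_ \in mhs_series); apply: funext => p; rewrite exprVn -invr_expz.
have := rpredX k.+1 (weighted_mhs_series (horner_prime_mhs g)).
by rewrite exprfctE NegzE opprK.
Qed.

Lemma cleared_ipow_series r d a (N : primeT -> nat) (g : {poly int}) :
  (size g <= d.+1)%N -> almost_all_primes (fun p => (N p).+1%:Z = g.[p%:Z]) ->
  (fun p : primeT => cleared_ipow r d p a (N p)) \in mhs_series.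
Proof.
move=> size_g NE; case: r.
  have := ripow_series a NE; congr (_ \in mhs_series); apply: funext => p.
  by rewrite /cleared_ipow mul1r.
have [g0|g_neq0] := eqVneq g 0.
  apply: eq_mhs_series (rpred0 _); apply: filterS NE => p.
  by rewrite g0 horner0.
case: a => k.
  have := rpredX k (horner_prime_quot_series g_neq0 size_g); rewrite exprfctE.
  apply: eq_mhs_series; apply: filterS NE => p; rewrite /horner_prime => <-.
  rewrite /cleared_ipow /= exprM exprMn exprVn.
  by rewrite /ripow /ipow -invr_expz -exprnP.
have := rpredX k.+1 (weighted_mhs_series (horner_prime_mhs g)).
rewrite exprfctE; apply: eq_mhs_series.
apply: filterS NE => p; rewrite /horner_prime => <-.
by rewrite /cleared_ipow /= muln0 mul1r /ripow /ipow NegzE opprK.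
Qed.

(** * Summation ranges given by polynomials *)

Definition cleared_summable (restricted : bool) (d : nat) (N : primeT -> nat) :
    Prop :=
  forall s,
    (fun p : primeT => cleared_hsum restricted d p s (N p)) \in mhs_series.

Lemma eq_cleared_summable r d N N' : almost_all_primes (fun p => N p = N' p) ->
  cleared_summable r d N' -> cleared_summable r d N.
Proof.
move=> NN' sumN' s; apply: eq_mhs_series (sumN' s).
by apply: filterS NN' => p ->.
Qed.

Lemma cleared_summable0 r d : cleared_summable r d (fun=> 0%N).
Proof.
move=> s; apply: weighted_mhs_series.
rewrite (_ : (fun _ => _) = cst (nilp s)%:R); first exact: weighted_mhs_cst.
by apply: funext => p; rewrite nsum0.
Qed.

Lemma cleared_summable_succ r d N :
  (forall a, (fun p : primeT => cleared_ipow r d p a (N p)) \in mhs_series) ->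
  cleared_summable r d N <-> cleared_summable r d (fun p => (N p).+1).
Proof.
move=> lastE; have consE a s :
    (fun p : primeT => cleared_hsum r d p (a :: s) (N p).+1) =
    (fun p : primeT => cleared_hsum r d p (a :: s) (N p)) +
    (fun p : primeT => cleared_ipow r d p a (N p)) *
    (fun p : primeT => cleared_hsum r d p s (N p)).
  by apply: funext => p; rewrite nsumS.
split=> sumN.
  case=> [|a s]; first exact: (sumN [::]).
  by rewrite consE; apply: rpredD => //; apply: rpredM.
elim=> [|a s IH]; first exact: (sumN [::]).
by rewrite -(rpredDr _ (rpredM (lastE a) IH)) -consE.
Qed.

Definition nonneg_at_primes (f : {poly int}) : Prop :=
  almost_all_primes (fun p => 0 <= f.[p%:Z]).

Lemma poly_val_succ f : nonneg_at_primes f ->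
  almost_all_primes (fun p => poly_val (f + 1) p = (poly_val f p).+1).
Proof.
by apply: filterS => p fp0; rewrite /poly_val hornerD hornerC; lia.
Qed.

Lemma cleared_summable_poly_succ r d f :
  nonneg_at_primes f -> (size (f + 1)%R <= d.+1)%N ->
  cleared_summable r d (poly_val f) <-> cleared_summable r d (poly_val (f + 1)).
Proof.
move=> f_ge0 size_f; have succE := poly_val_succ f_ge0.
have last_mem a :
    (fun p : primeT => cleared_ipow r d p a (poly_val f p)) \in mhs_series.
  apply: (cleared_ipow_series _ _ size_f); apply: filterS f_ge0 => p fp0.
  by rewrite hornerD hornerC /poly_val; lia.
rewrite (cleared_summable_succ last_mem).
split; apply: eq_cleared_summable => //.
by apply: filterS succE.
Qed.

Lemma size_addC_leq (R : nzRingType) (f : {poly R}) c d :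
  (size f <= d.+1)%N -> (size (f + c%:P)%R <= d.+1)%N.
Proof.
move=> size_f; apply: leq_trans (size_polyD _ _) _.
by rewrite geq_max size_f (leq_trans (size_polyC_leq1 _)).
Qed.

Lemma cleared_summable_addn r d f n :
  nonneg_at_primes f -> (size f <= d.+1)%N ->
  cleared_summable r d (poly_val f) <->
  cleared_summable r d (poly_val (f + (n%:Z)%:P)).
Proof.
move=> f_ge0 size_f; elim: n => [|n IH]; first by rewrite addr0.
rewrite IH -addn1 PoszD polyCD addrA; apply: cleared_summable_poly_succ.
  by apply: filterS f_ge0 => p; rewrite hornerD hornerC; lia.
by rewrite -[1]/(1%:P) !size_addC_leq.
Qed.

Lemma cleared_summable_addC r d f (c : int) :
  nonneg_at_primes f -> nonneg_at_primes (f + c%:P) -> (size f <= d.+1)%N ->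
  cleared_summable r d (poly_val f) <->
  cleared_summable r d (poly_val (f + c%:P)).
Proof.
case: c => n f_ge0 fc_ge0 size_f; first exact: cleared_summable_addn.
have := cleared_summable_addn r n.+1 fc_ge0 (size_addC_leq _ size_f).
by rewrite -addrA -polyCD NegzE addNr addr0 => ->.
Qed.

Lemma cleared_summable_mulp r d N :
  almost_all_primes (fun p => (N p < p ^ d.+1)%N) ->
  cleared_summable false d N ->
  cleared_summable r d.+1 (fun p => p * N p)%N.
Proof.
move=> N_lt sumN s.
apply: (mhs_expandable_pullback (X := below_power d) (Y := primes_family)
  (pt := fun p : primeT => (p, N p)))
  (cleared_hsum_mulp_expandable r d s) => //.
exact/near_primesP.
Qed.

Lemma lead_coef_gt0_eventually (f : {poly int}) : 0 < lead_coef f ->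
  eventually_nat (fun n => 0 < f.[n%:Z]).
Proof.
elim/poly_ind: f => [|f c IH]; first by rewrite lead_coef0.
have [->|f0] := eqVneq f 0.
  by rewrite mul0r add0r lead_coefC => c0; exists 0%N => n _; rewrite hornerC.
have fX : (size c%:P < size (f * 'X)%R)%N.
  rewrite size_mulX //; apply: leq_ltn_trans (size_polyC_leq1 c) _.
  by rewrite ltnS lt0n size_poly_eq0.
rewrite lead_coefDl // lead_coefMX => /IH[N fN].
exists (maxn N `|c|.+1) => n; rewrite geq_max => /andP[/fN fn cn].
by rewrite hornerD hornerMX hornerC; nia.
Qed.

Lemma lead_coef_ge0_primes (f : {poly int}) :
  0 <= lead_coef f -> nonneg_at_primes f.
Proof.
rewrite le_eqVlt eq_sym lead_coef_eq0 => /predU1P[->|].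
  by exists 0%N => p _; rewrite horner0.
by move=> /lead_coef_gt0_eventually[N fN]; exists N => p /fN/ltW.
Qed.

Lemma leq_poly_val f g : nonneg_at_primes f -> nonneg_at_primes (g - f) ->
  almost_all_primes (fun p => (poly_val f p <= poly_val g p)%N).
Proof.
apply: filterS2 => p; rewrite hornerD hornerN /poly_val.
by move: f.[_] g.[_] => x y; lia.
Qed.

Lemma poly_val_lt_exp f d : nonneg_at_primes f -> (size f <= d.+1)%N ->
  almost_all_primes (fun p => (poly_val f p < p ^ d.+1)%N).
Proof.
move=> f_ge0 size_f; have : 0 < lead_coef ('X^(d.+1) - f).
  by rewrite lead_coefDl ?lead_coefXn // size_polyN size_polyXn.
move=> /lead_coef_gt0_eventually[N fN]; have [M fM] := f_ge0.
exists (maxn M N) => p; rewrite geq_max => /andP[/fM fp0 /fN].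
rewrite hornerD hornerN hornerXn subr_gt0 -ltz_nat /poly_val gez0_abs //.
by rewrite -[Posz (p ^ _)]natz natrX natz.
Qed.

Lemma nonneg_at_primes_quotient (f : {poly int}) (c : int) :
  nonneg_at_primes (f * 'X + c%:P) -> nonneg_at_primes f.
Proof.
move=> [M fM]; exists (maxn M `|c|.+1) => p; rewrite geq_max => /andP[/fM + pc].
by rewrite hornerD hornerMX hornerC; nia.
Qed.

Lemma cleared_summable_MXaddC r d (f : {poly int}) (c : int) :
  nonneg_at_primes (f * 'X + c%:P) -> (size (f * 'X)%R <= d.+1)%N ->
  cleared_summable r d (fun p => p * poly_val f p)%N ->
  cleared_summable r d (poly_val (f * 'X + c%:P)).
Proof.
move=> fXc_ge0 size_fX sum_fX.
apply/(cleared_summable_addC r _ fXc_ge0 size_fX).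
  apply: filterS (nonneg_at_primes_quotient fXc_ge0) => p fp0.
  by rewrite hornerMX mulr_ge0.
apply: eq_cleared_summable sum_fX; apply: filterE => p.
by rewrite /poly_val hornerMX abszM mulnC.
Qed.

Lemma cleared_summable_poly r d f :
  nonneg_at_primes f -> (size f <= d.+1)%N -> cleared_summable r d (poly_val f).
Proof.
elim: d r f => [|d IH] r f f_ge0 size_f; have fE := poly_drop1E f.
- have q0 : drop_poly 1 f = 0.
    by apply/eqP; rewrite -size_poly_eq0 size_drop_poly; apply/eqP; lia.
  rewrite fE q0; rewrite fE q0 in f_ge0; apply: cleared_summable_MXaddC => //.
    by rewrite mul0r size_poly0.
  apply: eq_cleared_summable (cleared_summable0 r 0); apply: filterE => p.
  by rewrite /poly_val horner0 muln0.
- have size_q : (size (drop_poly 1 f) <= d.+1)%N by rewrite size_drop_poly; lia.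
  rewrite fE; rewrite fE in f_ge0; apply: cleared_summable_MXaddC => //.
    by apply: leq_trans (size_polyMleq _ _) _; rewrite size_polyX addn2.
  have q_ge0 := nonneg_at_primes_quotient f_ge0.
  apply: cleared_summable_mulp (IH _ _ q_ge0 size_q).
  exact: poly_val_lt_exp.
Qed.

Lemma cleared_summable_range r d M N :
  almost_all_primes (fun p => (M p <= N p)%N) ->
  cleared_summable r d M -> cleared_summable r d N ->
  forall s, (fun p : primeT =>
    nsum (fun a n => cleared_ipow r d p a (M p + n)) s (N p - M p))
  \in mhs_series.
Proof.
move=> MN sumM sumN s.
have [n] := ubnP (size s); elim: n s => // n IH s; rewrite ltnS => size_s.
pose range t (p : primeT) : rat :=
  nsum (fun a n => cleared_ipow r d p a (M p + n)%N) t (N p - M p).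
pose initial t (p : primeT) : rat := cleared_hsum r d p t (M p).
pose total (p : primeT) : rat := cleared_hsum r d p s (N p).
apply: (@eq_mhs_series _ (total -
  \sum_(k < size s) range (take k s) * initial (drop k s))).
  apply: filterS MN => p MNp.
  rewrite !fctE fct_sumE /total -[in RHS](subnKC MNp) nsum_cat big_ord_recr /=.
  by rewrite take_size drop_size mulr1 addrAC subrr add0r.
apply: rpredB; first exact: sumN.
apply: rpred_sum => k _; apply: rpredM; last exact: sumM.
by apply: IH; rewrite size_take ltn_ord; apply: leq_trans (ltn_ord k) _.
Qed.

Lemma cleared_range_poly_series r (f g : {poly int}) s :
  0 < lead_coef f -> 0 < lead_coef g ->
  (fun p : primeT =>
    nsum (fun a n => cleared_ipow r (size f).-1 p a (poly_val g p + n)) s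
      (poly_val f p - poly_val g p)) \in mhs_series.
Proof.
move=> f_lead g_lead.
have f_ge0 := lead_coef_ge0_primes (ltW f_lead).
have g_ge0 := lead_coef_ge0_primes (ltW g_lead).
have [fg|gf] := leP 0 (lead_coef (f - g)).
  have size_gf : (size g <= size f)%N.
    rewrite leqNgt; apply/negP => lt; move: fg.
    by rewrite lead_coefDr ?size_polyN // lead_coefN oppr_ge0 leNgt g_lead.
  apply: cleared_summable_range.
  - exact: leq_poly_val g_ge0 (lead_coef_ge0_primes fg).
  - by apply: cleared_summable_poly g_ge0 _; apply: leq_trans (leqSpred _).
  - exact: cleared_summable_poly f_ge0 (leqSpred _).
have gf_lead : 0 <= lead_coef (g - f) by rewrite -opprB lead_coefN oppr_ge0 ltW.
apply: eq_mhs_series (weighted_mhs_series (weighted_mhs_cst (nilp s)%:R)).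
apply: filterS (leq_poly_val f_ge0 (lead_coef_ge0_primes gf_lead)) => p.
by rewrite -subn_eq0 => /eqP->; rewrite nsum0.
Qed.

(** * Nested sums as sums over decreasing tuples *)

Lemma big_tuple_cons (R : Type) (idx : R) (op : Monoid.com_law idx) (k : nat)
    (T : finType) (P : pred (k.+1.-tuple T)) (F : k.+1.-tuple T -> R) :
  \big[op/idx]_(t | P t) F t =
  \big[op/idx]_(x : T)
    \big[op/idx]_(t : k.-tuple T | P [tuple of x :: t]) F [tuple of x :: t].
Proof.
rewrite pair_big_dep /=.
rewrite (reindex (fun xt : T * k.-tuple T => [tuple of xt.1 :: xt.2])) //=.
exists (fun t => (thead t, [tuple of behead t])) => [[x t] _|t _] /=.
  by congr (_, _); apply: val_inj.
by rewrite -tuple_eta.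
Qed.

Section DecreasingTuples.
Variables (A : Type) (a0 : A) (R : comPzRingType).

Lemma sum_decreasing_tuples (W : A -> nat -> R) s L N : (L <= N.+1)%N ->
  \sum_(t : (size s).-tuple 'I_N.+1
        | sorted gtn (map val t) && all (fun x : 'I_N.+1 => (x < L)%N) t)
    \prod_(i < size s) W (nth a0 s i) (tnth t i) = nsum W s L.
Proof.
elim: s L => [|a s IH] L LN.
  rewrite (big_pred1 [tuple]) => [|t]; first by rewrite big_ord0.
  by rewrite tuple0.
have cond_cons (x : 'I_N.+1) (t : (size s).-tuple 'I_N.+1) :
    path gtn x (map val t) &&
      ((x < L)%N && all (fun y : 'I_N.+1 => (y < L)%N) t) =
    (x < L)%N &&
      (sorted gtn (map val t) && all (fun y : 'I_N.+1 => (y < x)%N) t).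
  rewrite path_sortedE; last by move=> y z w zy yw; apply: ltn_trans yw zy.
  rewrite all_map; case: (ltnP x L) => xL; rewrite ?andbF //=.
  rewrite [X in X && _]andbC -andbA; congr (_ && _); apply: andb_idr.
  by apply: sub_all => y /= yx; apply: ltn_trans xL.
rewrite big_tuple_cons /= (big_ord_widen _ (fun i => W a i * nsum W s i) LN).
rewrite [RHS]big_mkcond /=; apply: eq_bigr => x _.
under eq_bigl do rewrite cond_cons.
case: ifP => xL; last by rewrite big_pred0.
rewrite -(IH x); last exact: ltnW.
rewrite mulr_sumr; apply: eq_bigr => t _; rewrite big_ord_recl; congr (_ * _).
by apply: eq_bigr => i _; rewrite !(tnth_nth ord0).
Qed.

Lemma sum_decreasing_tuples_all (W : A -> nat -> R) (c : pred nat) s N :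
  \sum_(t : (size s).-tuple 'I_N.+1
        | sorted gtn (map val t) && all (fun x : 'I_N.+1 => c x) t)
    \prod_(i < size s) W (nth a0 s i) (tnth t i) =
  nsum (fun a n => if c n then W a n else 0) s N.+1.
Proof.
rewrite -(sum_decreasing_tuples _ s (leqnn N.+1)) big_mkcondr.
apply: eq_big => [t|t _].
  by rewrite (introT allP) ?andbT // => x _; rewrite ltn_ord.
rewrite -forallb_tnth; case: ifP => [/forallP ct|/negbT].
  by apply: eq_bigr => i _; rewrite ct.
rewrite negb_forall => /existsP[i /negPf ci]; rewrite (bigD1 i) //= ci.
by rewrite mul0r.
Qed.

End DecreasingTuples.

Lemma not_dvdn_prod_tuple (r : bool) p k n (t : k.-tuple 'I_n) : prime p ->
  ~~ (r && (p %| \prod_(i < k) tnth t i)%N) =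
  all (fun x : 'I_n => ~~ (r && (p %| x)%N)) t.
Proof.
case: r => p_prime; last by rewrite all_predT.
by rewrite Euclid_dvd_prod // big_orE negb_exists -forallb_tnth.
Qed.

Lemma mhs_restr_nsum r (p : primeT) N M s :
  mhs_restr (fun m => ~~ (r && (p %| m)%N)) N M s =
  nsum (fun a n => ripow r p a (M + n)) s (N - M).
Proof.
pose c n := (M < n)%N && ~~ (r && (p %| n)%N).
pose W a n : rat := if c n then n%:R ^ (- a) else 0.
have -> : mhs_restr (fun m => ~~ (r && (p %| m)%N)) N M s = nsum W s N.+1.
  rewrite -(sum_decreasing_tuples_all 0 (fun a n => n%:R ^ (- a)) c) /mhs_restr.
  apply: eq_big => [t|t _]; last by apply: eq_bigr => i _; rewrite invr_expz.
  by rewrite not_dvdn_prod_tuple ?primeTP // -all_predI.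
have W0 a n : (n < M.+1)%N -> W a n = 0.
  by rewrite /W /c ltnS leqNgt => /negPf->.
have [MN|NM] := leqP M N.
  rewrite -{1}(subnKC MN) -addSn (nsum_shift _ _ W0); apply: eq_nsum => a n _.
  rewrite /W /c /ripow /ipow addSn ltnS leq_addr /=.
  by case: (r && _).
have -> : (N - M = 0)%N by lia.
rewrite nsum0; case: s => //= a s.
rewrite big1 // => i _; rewrite W0 ?mul0r // (leq_trans (ltn_ord i)) //.
by rewrite ltnS ltnW.
Qed.

Lemma S_sum_nsum (p : primeT) N M s :
  S_sum N M s = nsum (fun a n => ripow false p a (M + n)) s (N - M).
Proof. by rewrite -mhs_restr_nsum. Qed.

Lemma S_sum_p_nsum (p : primeT) N M s :
  S_sum_p p N M s = nsum (fun a n => ripow true p a (M + n)) s (N - M).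
Proof. by rewrite -mhs_restr_nsum. Qed.

Lemma H_sum_hsum_nat (p : primeT) N u : H_sum N u = hsum_nat u N.
Proof. by rewrite /H_sum (S_sum_nsum p) subn0. Qed.

(** * From expansions to the MHS algebra *)

Lemma is_class_of_exists (a : primeT -> rat) n :
  almost_all_primes (fun p => vp_ge p n (a p)) -> exists x, is_class_of a x.
Proof.
move=> [N aN].
pose u : prodQp := fun p => if (N <= p)%N then Qp_of_rat p (a p) else 0.
have u_bounded : u \in bounded_pred.
  apply/asboolP; exists n => p; rewrite /u; case: ifP => [/aN ?|_].
    exact/Qp_vge_rat.
  exact: Qp_vge0.
pose u' : boundedQp := exist (fun u => u \in bounded_pred) u u_bounded.
exists (\pi_Qpinf u'); exists u'; split=> //.
by exists N => p Np /=; rewrite /u Np.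
Qed.

Lemma is_class_ofB a a' x x' : is_class_of a x -> is_class_of a' x' ->
  is_class_of (a - a') (x - x').
Proof.
move=> [u [<- ua]] [v [<- va']]; exists (u - v); split; first exact: rmorphB.
apply: filterS2 ua va' => p up vp.
apply: etrans (esym (rmorphB (Qp_of_rat p) _ _)).
exact: (congr2 (fun y z => y - z) up vp).
Qed.

Lemma is_class_of0 : is_class_of 0 0.
Proof.
exists 0; split; first exact: rmorph0.
by exists 0%N => p _; rewrite [RHS]rmorph0.
Qed.

Lemma is_class_ofD a a' x x' : is_class_of a x -> is_class_of a' x' ->
  is_class_of (a + a') (x + x').
Proof.
move=> ax ax'; rewrite -[a']opprK -[x']opprK -[- a']sub0r -[- x']sub0r.
exact: is_class_ofB ax (is_class_ofB is_class_of0 ax').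
Qed.

Lemma is_class_of_sum (a : nat -> primeT -> rat) t m :
  (forall i, is_class_of (a i) (t i)) ->
  is_class_of (\sum_(i < m) a i) (\sum_(i < m) t i).
Proof.
move=> at_class; elim: m => [|m IH].
  by rewrite !big_ord0; apply: is_class_of0.
by rewrite !big_ord_recr; apply: is_class_ofD.
Qed.

Lemma is_class_of_Fil a x n : is_class_of a x ->
  almost_all_primes (fun p => vp_ge p n (a p)) -> Fil n x.
Proof.
move=> [u [<- ua]] a_ge; exists u; split=> //.
by apply: filterS2 ua a_ge => p -> ?; apply/Qp_vge_rat.
Qed.

Section Concatenation.
Variables (T : Type) (x0 : T) (L : nat -> seq T).
Hypothesis L_gt0 : forall j, (0 < size (L j))%N.

Definition concat_lt J : seq T := flatten (mkseq L J).
(* The [L j] being nonempty, the first [i.+1] of them have an [i]-th entry. *)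
Definition concat i : T := nth x0 (concat_lt i.+1) i.

Lemma concat_ltS J : concat_lt J.+1 = concat_lt J ++ L J.
Proof.
by rewrite /concat_lt /mkseq -addn1 iotaD map_cat flatten_cat /= cats0.
Qed.

Lemma size_concat_lt J : (J <= size (concat_lt J))%N.
Proof.
by elim: J => // J IH; rewrite concat_ltS size_cat; have := L_gt0 J; lia.
Qed.

Lemma concat_lt_prefix J K : (J <= K)%N ->
  exists2 r, concat_lt K = concat_lt J ++ r &
  forall P : pred T, (forall j, (J <= j)%N -> all P (L j)) -> all P r.
Proof.
move=> /subnKC <-; elim: (K - J)%N => [|n [r rE rP]].
  by rewrite addn0; exists [::]; rewrite ?cats0.
exists (r ++ L (J + n)) => [|P LP]; first by rewrite addnS concat_ltS rE catA.
by rewrite all_cat rP // LP ?leq_addr.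
Qed.

Lemma concatE J i :
  (i < size (concat_lt J))%N -> concat i = nth x0 (concat_lt J) i.
Proof.
move=> iJ.
have [/concat_lt_prefix[r LE _]|/ltnW/concat_lt_prefix[r LE _]] := leqP J i.+1.
  by rewrite /concat LE nth_cat iJ.
by rewrite LE nth_cat size_concat_lt.
Qed.

Lemma concat_all (P : pred T) J : (forall j, (J <= j)%N -> all P (L j)) ->
  forall i, (size (concat_lt J) <= i)%N -> P (concat i).
Proof.
move=> LP i Ji; have /concat_lt_prefix[r LE rP] : (J <= i.+1)%N.
  by have := size_concat_lt J; lia.
have := size_concat_lt i.+1; rewrite LE size_cat => i_lt.
rewrite /concat LE nth_cat ltnNge Ji /=.
by apply: (all_nthP x0 (rP P LP)); lia.
Qed.

Lemma sum_concat (V : nmodType) (g : T -> V) J m :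
  \sum_(i < size (concat_lt J) + m) g (concat i) =
  \sum_(j < J) \sum_(x <- L j) g x +
  \sum_(i < m) g (concat (size (concat_lt J) + i)).
Proof.
rewrite big_split_ord /=; congr (_ + _).
transitivity (\sum_(x <- concat_lt J) g x).
  rewrite (big_nth x0) big_mkord; apply: eq_bigr => i _.
  by rewrite (concatE (ltn_ord i)).
elim: J => [|J IH]; first by rewrite big_nil big_ord0.
by rewrite concat_ltS big_cat IH big_ord_recr.
Qed.

End Concatenation.

Definition mhs_term : Type := (rat * nat * seq nat)%type.

Definition eval_term (t : mhs_term) : primeT -> rat :=
  weighted_hsum t.1.1 t.1.2 t.2.

Lemma weighted_mhs_sum phi : phi \in weighted_mhs ->
  exists2 l : seq mhs_term, all (fun t => is_composition t.2) l &
    phi = \sum_(t <- l) eval_term t.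
Proof.
move=> /asboolP; elim=> [|_ [c [k [u [cu ->]]]]|C D _ [l lc ->] _ [m mc ->]].
- by exists [::]; rewrite ?big_nil.
- by exists [:: (c, k, u)]; rewrite ?big_seq1 /= ?andbT.
exists (l ++ [seq (- t.1.1, t.1.2, t.2) | t <- m]).
  by rewrite all_cat lc all_map.
rewrite big_cat big_map -sumrN; congr (_ + _); apply: eq_bigr => t _.
by apply: funext => p; rewrite !fctE /eval_term /weighted_hsum !mulNr.
Qed.

Lemma weighted_mhs_sum_primeX phi (j : nat) : phi \in weighted_mhs ->
  exists l : seq mhs_term,
    [/\ (0 < size l)%N, all (fun t => is_composition t.2) l,
        all (fun t => j <= t.1.2)%N l
      & \sum_(t <- l) eval_term t = prime_fun primes_family ^+ j * phi].
Proof.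
move=> /weighted_mhs_sum[l l_comp ->].
(* The first term is zero and only makes the list nonempty. *)
exists ((0, j, [::]) :: [seq (t.1.1, (j + t.1.2)%N, t.2) | t <- l]).
split=> //; first by rewrite /= all_map.
  by rewrite /= leqnn all_map; apply/allP => t _ /=; apply: leq_addr.
rewrite big_cons big_map mulr_sumr [X in X + _](_ : _ = 0) ?add0r; last first.
  by apply: funext => p; rewrite /eval_term /weighted_hsum !mul0r.
apply: eq_bigr => t _; apply: funext => p.
rewrite !fctE /eval_term /weighted_hsum /prime_fun exprD /=.
by move: (hsum_nat _ _) => h; ring.
Qed.

Lemma mhs_series_terms phi : phi \in mhs_series ->
  exists e : nat -> mhs_term,
    [/\ forall i, is_composition (e i).2,
        forall J, eventually_nat (fun i => J <= (e i).1.2)%N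
      & forall J : nat, eventually_nat (fun m =>
          phi - \sum_(i < m) eval_term (e i) \in vge primes_family J)].
Proof.
move=> /asboolP[F FM phiE].
have F_mhs j : F j \in weighted_mhs by rewrite -mem_mhs_span_one_basis.
have /choice[L LP] j := weighted_mhs_sum_primeX j (F_mhs j).
have L_gt0 j : (0 < size (L j))%N by have [] := LP j.
pose e := concat (0, 0%N, [::]) L.
have e_weight J i : (size (concat_lt L J) <= i)%N -> (J <= (e i).1.2)%N.
  apply: (concat_all _ L_gt0 (P := fun t => J <= t.1.2)%N) => j Jj.
  by have [_ _ Lj _] := LP j; apply: sub_all Lj => t; apply: leq_trans.
exists e; split=> [i|J|J].
- apply: (concat_all (J := 0) _ L_gt0 (P := fun t => is_composition t.2)) => //.
  by move=> j _; have [] := LP j.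
- by exists (size (concat_lt L J)) => i; apply: e_weight.
exists (size (concat_lt L J.+1)) => m /subnKC <-; move: (m - _)%N => r.
rewrite sum_concat // opprD addrA; apply: rpredB.
  under eq_bigr => j _ do have [_ _ _ ->] := LP j.
  by apply: vge_le (phiE J); rewrite lez_nat leqnSn.
apply: rpred_sum => i _.
apply: vge_le (weighted_hsum_vge primes_family _ _ _).
by rewrite lez_nat ltnW // e_weight // leq_addr.
Qed.

Lemma vp_ge_unscale (p : primeT) (n m : int) x :
  vp_ge p m (p%:R ^ (- n) * x) -> vp_ge p (n + m) x.
Proof.
have p0 := natr_primeT_neq0 p.
move=> x_ge; rewrite -[x](mulKf (expfz_neq0 (- n) p0)) invr_expz opprK.
by apply: vp_geM => //; apply: vp_ge_prime_exprz.
Qed.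

Lemma FilMHS_of_series (n : int) (a : primeT -> rat) :
  (fun p : primeT => p%:R ^ (- n) * a p) \in mhs_series ->
  exists2 x, is_class_of a x & FilMHS n x.
Proof.
move=> /[dup] a_series /mhs_series_terms[e [e_comp e_weight e_sum]].
have unscale m phi :
    (fun p : primeT => p%:R ^ (- n) * phi p) \in vge primes_family m ->
    almost_all_primes (fun p => vp_ge p (n + m) (phi p)).
  move=> /asboolP/near_primesP; apply: filterS => p; exact: vp_ge_unscale.
pose term i (p : primeT) : rat :=
  (e i).1.1 * p%:R ^ (n + (e i).1.2%:Z) * H_sum p.-1 (e i).2.
have termE i : (fun p : primeT => p%:R ^ (- n) * term i p) = eval_term (e i).
  apply: funext => p.
  rewrite /term /eval_term /weighted_hsum (H_sum_hsum_nat p).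
  rewrite !mulrA [_ * (e i).1.1]mulrC -[_ * _ * p%:R ^ _]mulrA.
  by rewrite -expfzDr ?natr_primeT_neq0 // addKr.
have [x ax] : exists x, is_class_of a x.
  by apply: (@is_class_of_exists _ (n + 0)); apply/unscale/mhs_series_integral.
have /choice[t term_t] i : exists y, is_class_of (term i) y.
  apply: (@is_class_of_exists _ (n + (e i).1.2%:Z)); apply: unscale.
  by rewrite termE; apply: (weighted_hsum_vge primes_family).
exists x => //.
exists (fun i => (e i).1.1), (fun i => n + (e i).1.2%:Z), (fun i => (e i).2).
split; last by move=> i; lia.
split=> // [B|].
  by have [M eM] := e_weight `|B - n|%N; exists M => i /eM; lia.
exists t => // B; have [M eM] := e_sum `|B - n|%N; exists M => m /eM diff_vge.
apply: (is_class_of_Fil (is_class_ofB ax (is_class_of_sum m term_t))).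
have : almost_all_primes (fun p =>
    vp_ge p (n + `|B - n|%N) ((a - \sum_(i < m) term i) p)).
  apply: unscale; move: diff_vge; congr (_ \in vge primes_family _).
  apply: funext => p.
  rewrite !fctE !fct_sumE mulrBr mulr_sumr; congr (_ - _).
  by apply: eq_bigr => i _; rewrite -termE.
by apply: filterS => p; apply: vp_ge_le; lia.
Qed.

Lemma pos_part_sum s :
  \sum_(z <- s) pos_part z = (\sum_(z <- s) pos_nat z)%N%:Z.
Proof.
rewrite -[RHS]natz natr_sum; apply: eq_bigr => z _.
by rewrite natz; case: z => // -[].
Qed.

Theorem theorem3 (s : seq int) (f g : {poly int})
    (hf : 0 < lead_coef f) (hg : 0 < lead_coef g) :
  (exists2 x : Qpinf,
      is_class_of (fun p : primeT => S_sum (poly_val f p) (poly_val g p) s) x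
    & FilMHS (- ((size f).-1%:Z * \sum_(z <- s) pos_part z)) x) /\
  (exists2 x : Qpinf,
      is_class_of (fun p : primeT => S_sum_p p (poly_val f p) (poly_val g p) s) x
    & FilMHS 0 x).
Proof.
split; apply: FilMHS_of_series.
  have := cleared_range_poly_series false s hf hg.
  congr (_ \in mhs_series); apply: funext => p.
  rewrite nsum_scale prodrXr -big_distrr /= -(S_sum_nsum p).
  by rewrite opprK pos_part_sum -PoszM.
have := cleared_range_poly_series true s hf hg.
congr (_ \in mhs_series); apply: funext => p.
rewrite nsum_scale prodrXr big1 // expr0 oppr0 expr0z; congr (_ * _).
by rewrite -(S_sum_p_nsum p).
Qed.
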